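(* Let $0<\gamma<1$, let $f$ be nonnegative, non-decreasing and locally Lipschitz on $[0,\infty)$, let $u_0>0$ and let $k>0$. Let $\{u^n\}_{n\ge0}$, with $u^0=u_0$, solve either the numerical scheme $$u^{n}=u_0+\frac{k^{\gamma}}{\Gamma(1+\gamma)}\sum_{m=0}^{n-1}f(u^{m})\Big((n-m)^{\gamma}-(n-m-1)^{\gamma}\Big)$$ or the numerical scheme $$u^{n}=u_0+\frac{k^{\gamma}}{\Gamma(\gamma)}\sum_{m=0}^{n-1}f(u^{m})(n-m)^{\gamma-1}.$$ Let $u$ be the unique solution of $D_c^{\gamma}u=f(u)$ with $u(0)=u_0$, with interval of existence $[0,T_b)$. Then $$u^{n-1}\le u^n\le u(nk),\qquad 1\le n<T_b/k.$$
   Context: Fix $\gamma\in(0,1)$. A function $u\in L^1_{loc}(0,T)$ has right limit $u(0+)=u_0$ at $t=0$ if $\lim_{t\to0+}\frac1t\int_0^t|u(s)-u_0|\,ds=0$. For such $u$, the (generalized) Caputo derivative is the distribution on $(-\infty,T)$ supported in $[0,T)$ given by $D_c^{\gamma}u=g_{-\gamma}*\big((u-u(0+))\theta(t)\big)$, where $\theta$ is the Heaviside function and $g_{-\gamma}=\frac{1}{\Gamma(1-\gamma)}D\big(\theta(t)t^{-\gamma}\big)$ with $D$ the distributional derivative. A strong solution of $D_c^\gamma u=f(u)$, $u(0)=u_0$, is such a $u$ with $u(0+)=u_0$, $D_c^{\gamma}u\in L^1(0,T)$, satisfying the equation almost everywhere. It is known that for continuous $u$ the problem is equivalent to the Volterra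 equation $u(t)=u_0+\frac{1}{\Gamma(\gamma)}\int_0^t(t-s)^{\gamma-1}f(u(s))\,ds$. Under the hypotheses there is a unique continuous strong solution on a maximal interval $[0,T_b)$, $T_b\in(0,\infty]$, with $\limsup_{t\to T_b^-}u(t)=\infty$ if $T_b<\infty$. Here $k$ is the time step. *)

(* Defs.v *)
From HB Require Import structures.
From mathcomp Require Import all_boot all_order all_algebra.
From mathcomp Require Import all_classical all_reals all_analysis.

Set Implicit Arguments.
Unset Strict Implicit.
Unset Printing Implicit Defensive.

Import Order.TTheory GRing.Theory Num.Theory.
Import numFieldNormedType.Exports.

Local Open Scope classical_set_scope.
Local Open Scope ring_scope.

Section fractional_ode.
Context {R : realType}.
Local Notation mu := (@lebesgue_measure R).
Implicit Types (u v w f : R -> R) (phi : R -> R) (G : (R -> R) -> R).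

Definition Gamma (z : R) : R :=
  \int[mu]_(t in `]0, +oo[) (t `^ (z - 1) * expR (- t)).

Definition heaviside (t : R) : R := (0 <= t)%R%:R.

(* A distribution is represented by its action on functions. *)

Definition test_function (T : R) phi : Prop :=
  (forall (n : nat) (x : R), derivable (derive1n n phi) x 1) /\
  exists a b : R, b < T /\ forall x, phi x != 0 -> a <= x <= b.

Definition regular (h : R -> R) : (R -> R) -> R :=
  fun phi => \int[mu]_x (h x * phi x).

Definition distr_derive G : (R -> R) -> R := fun phi => - G (derive1 phi).

(* <G * w, phi> = < G(x), <w(y), phi(x + y)> >.  It is used with G and w
   supported in [0, +oo[.  Then only x, y >= 0 matter, so if phi is a test
   function on ]-oo, T[ the inner integral vanishes for large x (it need not
   have support bounded on the left), and the values of w on [T, +oo[ play no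
   role. *)
Definition distr_conv G w : (R -> R) -> R :=
  fun phi => G (fun x => \int[mu]_y (w y * phi (x + y))).

Definition g_minus (gamma : R) : (R -> R) -> R :=
  fun phi => (Gamma (1 - gamma))^-1 *
    distr_derive (regular (fun t => heaviside t * t `^ (- gamma))) phi.

(* u0 stands for the right limit u(0+). *)
Definition caputo (gamma u0 : R) u : (R -> R) -> R :=
  distr_conv (g_minus gamma) (fun t => (u t - u0) * heaviside t).

(* The integral is extended-real valued: it is +oo, and not a default value,
   when u - u0 is not integrable near 0. *)
Definition right_limit0 u (u0 : R) : Prop :=
  ((t^-1)%:E * \int[mu]_(s in `]0%R, t[) `|u s - u0|%:E)%E
    @[t --> (0 : R)^'+] --> 0%E.

(* The sign condition says that u takes its values in the domain [0, +oo[ of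
   the nonlinearity f, which is encoded as a total function.  The function v
   is the L^1(0, T) representative of the Caputo derivative. *)
Definition strong_solution (gamma : R) f (u0 T : R) u : Prop :=
  [/\ locally_integrable `]0, T[ u,
      right_limit0 u u0,
      forall t, 0 < t < T -> 0 <= u t &
      exists v : R -> R,
        [/\ mu.-integrable `]0, T[ (EFin \o v),
            forall phi, test_function T phi ->
              caputo gamma u0 u phi = \int[mu]_(t in `]0, T[) (v t * phi t) &
            {ae mu, forall t, 0 < t < T -> v t = f (u t)}]].

(* On [0, Tb[ the Caputo derivative is only required to be integrable on
   ]0, T[ for every finite T < Tb: f (u t) may fail to be integrable up to a
   blow-up time Tb.  Continuity at 0 and right_limit0 give u 0 = u0. *)
Definition continuous_strong_solution
    (gamma : R) f (u0 : R) (Tb : \bar R) u : Prop :=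
  {within [set t : R | 0 <= t /\ (t%:E < Tb)%E], continuous u} /\
  forall T : R, 0 < T -> (T%:E < Tb)%E -> strong_solution gamma f u0 T u.

Definition maximal_solution
    (gamma : R) f (u0 : R) (Tb : \bar R) u : Prop :=
  continuous_strong_solution gamma f u0 Tb u /\
  forall (T' : \bar R) v, (Tb <= T')%E ->
    continuous_strong_solution gamma f u0 T' v ->
    (forall t, 0 <= t -> (t%:E < Tb)%E -> v t = u t) -> T' = Tb.

Definition locally_lipschitz_nonneg f : Prop :=
  forall x : R, 0 <= x ->
    exists2 r : R, 0 < r &
      [lipschitz f y | y in ball x r `&` [set y : R | 0 <= y]].

(* In the last term n - m.+1 = 0, and 0 `^ gamma = 0 for gamma > 0. *)
Definition integral_scheme (gamma k : R) f (u0 : R) (U : nat -> R) : Prop :=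
  forall n : nat, (1 <= n)%N ->
    U n = u0 + k `^ gamma / Gamma (1 + gamma) *
      \sum_(0 <= m < n)
        f (U m) * ((n - m)%:R `^ gamma - (n - m.+1)%:R `^ gamma).

Definition pointwise_scheme (gamma k : R) f (u0 : R) (U : nat -> R) : Prop :=
  forall n : nat, (1 <= n)%N ->
    U n = u0 + k `^ gamma / Gamma gamma *
      \sum_(0 <= m < n) f (U m) * (n - m)%:R `^ (gamma - 1).

End fractional_ode.

(* Main.v *)
Require Import Defs.
From HB Require Import structures.
From mathcomp Require Import all_boot all_order all_algebra.
From mathcomp Require Import all_classical all_reals all_analysis.
From mathcomp Require Import measurable_realfun.
From mathcomp Require Import ring lra.

(** The scheme is an explicit discretization, from below, of the Volterra
    equation u(s) = u0 + (1/Gamma(gamma)) int_0^s t^(gamma-1) f(u(s-t)) dt.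
    Indexed by the lag i = n-1-m, both schemes read
    U(n) = u0 + sum_(i < n) c_i f(U(n-1-i)) with c_i >= 0 and
    Gamma(gamma) c_i <= int_(ik)^((i+1)k) t^(gamma-1) dt
    ([integral_scheme_weighted], [pointwise_scheme_weighted]).  Nonnegative
    weights applied to a nondecreasing f make U nondecreasing, by induction
    ([weighted_scheme_nondecr]).

    For the comparison, the statement that carries an induction on m is
    U(m) <= u(s) for all s >= mk ([weighted_scheme_below]).  If the lag t lies
    in ]ik, (i+1)k] then s - t >= (m-1-i)k, so the induction hypothesis gives
    f(u(s-t)) >= f(U(m-1-i)) at every time s - t that occurs, and the memory
    integral of u dominates, cell by cell, the sum that defines U(m).

    The Volterra equation has to be extracted from the distributional one, and
    it is used only after integration against a bump D:
    Gamma(gamma) int (u - u0) D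
      = int t^(gamma-1) int f(u(s)) D(s+t) ds dt   ([tested_volterra_bump]).
    Here D is a difference of two smooth nonincreasing cut-offs A.  For one
    cut-off, the Caputo derivative is tested on the translates A(. + t), t >= 0
    ([potential_balance]).  The slope -A' is nonnegative, so after the
    contributions of u and of u0 have been put on different sides all integrands
    are nonnegative.  Integrating the balance against t^(gamma-1) dt,
    exchanging the integrals, and using the convolution identity
    int int t^(gamma-1) x^(-gamma) H(x+t) dx dt
      = Gamma(gamma) Gamma(1-gamma) int H
    ([beta_convolution], [stieltjes_ker_gamma]) undoes the fractional
    differentiation.

    If u(s) < U(m) at some s >= mk, continuity provides a d < U(m) that bounds
    u on an interval ]s, b[.  A bump supported there gives U(m) <= d, which is
    absurd ([strong_solution_lower_bound]). *)

Set Implicit Arguments.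
Unset Strict Implicit.
Unset Printing Implicit Defensive.

Import Order.TTheory GRing.Theory Num.Theory.
Import numFieldNormedType.Exports.

Local Open Scope classical_set_scope.
Local Open Scope ring_scope.

(** * Smooth cut-offs *)

Section iterated_derivability.
Context {R : realType}.
Implicit Types f g : R -> R.

(** Derivability up to order n by recursion on the derivative, the form in which
    the closure properties below are proved by induction on n. *)
Fixpoint nderivable (n : nat) f : Prop :=
  if n is m.+1 then (forall x : R, derivable f x 1) /\ nderivable m (derive1 f)
  else True.

Lemma is_derive_derive1 f (x d : R) : is_derive x 1 f d -> (derive1 f) x = d.
Proof. by move=> [_ <-]; rewrite derive1E. Qed.

Lemma derivable_is_derive f (x : R) : derivable f x 1 -> is_derive x 1 f ((derive1 f) x).
Proof. by move=> df; rewrite derive1E; exact: derivableP. Qed.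

(** Reduces n+1 derivatives to n derivatives of any explicit formula for the
    first one. *)
Lemma nderivableS n f (f' : R -> R) : (forall x : R, is_derive x 1 f (f' x)) ->
  nderivable n f' -> nderivable n.+1 f.
Proof.
move=> df nf'; split; first by move=> x; case: (df x).
by have -> : (derive1 f) = f' by apply/funext => x; exact: is_derive_derive1.
Qed.

Lemma nderivableW n f : nderivable n.+1 f -> nderivable n f.
Proof.
by elim: n f => [//|n IH] f [df nf]; split => //; exact: IH.
Qed.

Lemma nderivable_derive1n f : (forall n, nderivable n f) ->
  forall n (x : R), derivable (derive1n n f) x 1.
Proof.
move=> nf n; elim: n f nf => [|n IH] f nf x; first by have [] := nf 1%N.
by rewrite derive1Sn; apply: IH => m; have [] := nf m.+1.
Qed.

Lemma nderivable_cst n (c : R) : nderivable n (cst c).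
Proof.
elim: n c => [//|n IH] c; apply: (@nderivableS _ _ (cst 0)) => //.
Qed.

Lemma nderivableD n f g :
  nderivable n f -> nderivable n g -> nderivable n (f \+ g).
Proof.
elim: n f g => [//|n IH] f g [df nf] [dg ng].
apply: (@nderivableS _ _ ((derive1 f) \+ (derive1 g))); last exact: IH.
by move=> x; apply: is_deriveD; exact: derivable_is_derive.
Qed.

Lemma nderivableM n f g :
  nderivable n f -> nderivable n g -> nderivable n (f \* g).
Proof.
elim: n f g => [//|n IH] f g nf ng.
apply: (@nderivableS _ _ ((f \* (derive1 g)) \+ (g \* (derive1 f)))).
  by move=> x; apply: is_deriveM; apply: derivable_is_derive;
    [case: nf|case: ng].
apply: nderivableD; apply: IH; [exact: nderivableW|by case: ng|
  exact: nderivableW|by case: nf].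
Qed.

Lemma nderivableZ n (c : R) f :
  nderivable n f -> nderivable n (fun x => c * f x).
Proof. by move=> nf; apply: (@nderivableM n (cst c)) => //; exact: nderivable_cst. Qed.

Lemma nderivableV n f : (forall x, f x != 0) ->
  nderivable n f -> nderivable n (fun x => (f x)^-1).
Proof.
move=> f0; elim: n => [//|n IH] nf.
have nV := IH (nderivableW nf).
apply: (@nderivableS _ _ (((fun x => (f x)^-1) \* (fun x => (f x)^-1)) \*
   (fun x => -1 * (derive1 f) x))).
  move=> x; have df : is_derive x 1 f ((derive1 f) x).
    by apply: derivable_is_derive; case: nf.
  apply: (is_derive_eq (is_deriveV (f0 x) df)).
  by rewrite /GRing.scale /= -exprVn expr2 mulN1r mulrN mulNr.
apply: nderivableM; first exact: nderivableM.
by apply: nderivableZ; case: nf.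
Qed.

Lemma nderivable_affine n (a b : R) f :
  nderivable n f -> nderivable n (fun x => f (a * x + b)).
Proof.
elim: n f => [//|n IH] f [df nf].
apply: (@nderivableS _ _ (fun x => a * (derive1 f) (a * x + b))).
  move=> x.
  have daff : is_derive x 1 (fun x : R => a * x + b) a.
    have := is_deriveD (is_deriveZ a (is_derive_id x (1 : R)))
      (is_derive_cst b x 1).
    by rewrite /GRing.scale /= mulr1 addr0.
  rewrite mulrC; apply: (@is_derive1_comp _ f (fun x : R => a * x + b)).
  exact: derivable_is_derive.
by apply: nderivableZ; exact: IH.
Qed.

Lemma nondecreasing_derive1_ge0 f (x : R) : {homo f : x y / x <= y} ->
  derivable f x 1 -> 0 <= (derive1 f) x.
Proof.
move=> ndf df; apply: limr_ge.
  by under eq_fun; first (move=> h; rewrite -{2}(scaler1 h); over).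
near=> h.
have h0 : h != 0%R by near: h; exact: nbhs_dnbhs_neq.
rewrite /GRing.scale /=; move: h0; rewrite neq_lt => /orP[h0|h0].
- by rewrite nmulr_rge0 ?invr_lt0// subr_le0 ndf// gerDr ltW.
- by rewrite pmulr_rge0 ?invr_gt0// subr_ge0 ndf// lerDr ltW.
Unshelve. all: end_near. Qed.

End iterated_derivability.

Section smooth_step.
Context {R : realType}.

(** The family x^-n exp(-1/x), x > 0, is closed under differentiation up to
    linear combinations, hence all its members are smooth at once. *)
Definition flat (n : nat) (x : R) : R :=
  if 0 < x then x ^- n * expR (- x^-1) else 0.

Lemma flat_le0 n x : x <= 0 -> flat n x = 0.
Proof. by move=> x0; rewrite /flat ltNge x0. Qed.

Lemma flat_ge0 n x : 0 <= flat n x.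
Proof.
rewrite /flat; case: ifPn => // x0.
by rewrite mulr_ge0 ?expR_ge0// invr_ge0 exprn_ge0 ?ltW.
Qed.

(** Makes [flat n.+1] the difference quotient of [flat n] at 0. *)
Lemma flat_mul n x : flat n x = x * flat n.+1 x.
Proof.
rewrite /flat; case: ifPn => [x0|]; last by rewrite mulr0.
by rewrite mulrA exprS invfM mulrA divff ?mul1r// gt_eqF.
Qed.

(** From exp(y) >= y^(n+1)/(n+1)! at y = 1/x; yields continuity at 0. *)
Lemma flat_linear_bound n x : flat n x <= n.+1`!%:R * `|x|.
Proof.
rewrite /flat; case: ifPn => [x0|_]; last by rewrite mulr_ge0.
rewrite gtr0_norm// expRN.
have f0 : (0 : R) < n.+1`!%:R by rewrite ltr0n fact_gt0.
have e0 := expR_gt0 (x^-1).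
have := @expR_ge1Dxn R x^-1 n; rewrite invr_ge0 (ltW x0) => /(_ isT) H.
have {}H : x^-1 ^+ n.+1 <= n.+1`!%:R * expR x^-1.
  rewrite mulrC -ler_pdivrMr//; apply: le_trans H; by rewrite lerDr.
have -> : x ^- n = x * x^-1 ^+ n.+1.
  by rewrite exprS mulrA mulfV ?gt_eqF// mul1r exprVn.
by rewrite ler_pdivrMr// mulrAC [leRHS]mulrC ler_wpM2l// ltW.
Qed.

Lemma is_derive_flat n (x : R) :
  is_derive x 1 (flat n) (flat n.+2 x - n%:R * flat n.+1 x).
Proof.
have [x0|x0|->] := ltgtP x 0.
- have -> : flat n.+2 x - n%:R * flat n.+1 x = 0.
    by rewrite !flat_le0 ?ltW// mulr0 subr0.
  apply: (near_eq_is_derive (f := cst 0)) => //.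
  have : \forall y \near x, y < 0 by exact: lt_nbhsl.
  by apply: filterS => y y0; rewrite flat_le0 ?ltW.
- have xN0 : x != 0 by rewrite gt_eqF.
  have dV : is_derive x 1 (fun y : R => y^-1) (- x ^- 2).
    have := @is_deriveV _ id x 1 1 xN0 (is_derive_id _ _).
    by rewrite /GRing.scale /= mulr1.
  have d1 : is_derive x 1 (fun y : R => expR (- y^-1)) (expR (- x^-1) * x ^- 2).
    have dN : is_derive x 1 (fun y : R => - y^-1) (x ^- 2).
      by apply: is_derive_eq; rewrite opprK.
    exact: (@is_derive1_comp _ expR (fun y => - y^-1)).
  have dX : is_derive x 1 (fun y : R => y^-1 ^+ n) (- (n%:R * x ^- n.+1)).
    rewrite -[X in is_derive _ _ X](exprfctE (fun y : R => y^-1)).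
    apply: (is_derive_eq (is_deriveX n dV)).
    rewrite /GRing.scale /= -mulr_natl mulrN; congr (- _).
    case: (n) => [|m] /=; first by rewrite !mul0r.
    by rewrite mulr1 -mulrA -!exprVn -exprD addn2.
  apply: (near_eq_is_derive (f := fun y : R => y^-1 ^+ n * expR (- y^-1))).
    have : \forall y \near x, 0 < y by exact: lt_nbhsr.
    by apply: filterS => y y0; rewrite /flat y0 exprVn.
  apply: (is_derive_eq (is_deriveM dX d1)).
  rewrite /flat x0 /GRing.scale /= -!exprVn.
  by rewrite !exprS; ring.
- rewrite !flat_le0// mulr0 subr0.
  apply/is_derive1_caratheodory; exists (flat n.+1); split.
  + by move=> z; rewrite (flat_le0 n (lexx _)) !subr0 mulrC -flat_mul.
  + have f0 : flat n.+1 (0 : R) = 0 by rewrite flat_le0.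
    have small (e : R) : 0 < e ->
        \forall y \near (0 : R), `|y| <= e / n.+2`!%:R.
      move=> e0; apply/nbhs_ballP; exists (e / n.+2`!%:R) => /=.
        by rewrite divr_gt0// ltr0n fact_gt0.
      by move=> y; rewrite /ball /= sub0r normrN => /ltW.
    apply/cvgrPdist_le => e e0; near=> y.
    rewrite f0 sub0r normrN ger0_norm ?flat_ge0//.
    apply: le_trans (flat_linear_bound _ _) _.
    rewrite mulrC -ler_pdivlMr ?ltr0n ?fact_gt0//.
    by near: y; exact: small.
  + by rewrite flat_le0.
Unshelve. all: by end_near. Qed.

Lemma nderivable_flat k n : nderivable k (flat n).
Proof.
elim: k n => [//|k IH] n.
apply: (nderivableS (is_derive_flat n)).
apply: nderivableD; first exact: IH.
have -> : (fun x => - (n%:R * flat n.+1 x)) = (fun x => - n%:R * flat n.+1 x).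
  by apply/funext => x; rewrite mulNr.
by apply: nderivableZ; exact: IH.
Qed.

Lemma flat0_homo : {homo flat 0 : x y / x <= y}.
Proof.
move=> x y xy; rewrite {1}/flat; case: ifPn => [x0|_]; last exact: flat_ge0.
have y0 := lt_le_trans x0 xy.
by rewrite /flat y0 !expr0 invr1 !mul1r ler_expR lerN2 lef_pV2.
Qed.

Lemma flat0_gt0 x : 0 < x -> 0 < flat 0 x.
Proof. by move=> x0; rewrite /flat x0 mulr_gt0 ?expR_gt0// expr0 invr1. Qed.

(** The denominator never vanishes since x > 0 or 1 - x > 0; with it the step
    is exactly 1 on [1, +oo[. *)
Definition smooth_step (x : R) : R := flat 0 x / (flat 0 x + flat 0 (1 - x)).

Lemma smooth_step_den_gt0 x : 0 < flat 0 x + flat 0 (1 - x).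
Proof.
have [x0|x0] := ltP 0 x; first by rewrite ltr_pwDl ?flat0_gt0 ?flat_ge0.
by rewrite ltr_wpDl ?flat_ge0 ?flat0_gt0//; lra.
Qed.

Lemma smooth_step_le0 x : x <= 0 -> smooth_step x = 0.
Proof. by move=> x0; rewrite /smooth_step flat_le0// mul0r. Qed.

Lemma smooth_step_ge1 x : 1 <= x -> smooth_step x = 1.
Proof.
move=> x1; rewrite /smooth_step [flat 0 (1 - x)]flat_le0 ?subr_le0// addr0.
by rewrite divff// gt_eqF// flat0_gt0// (lt_le_trans ltr01).
Qed.

Lemma smooth_step_homo : {homo smooth_step : x y / x <= y}.
Proof.
move=> x y xy; rewrite /smooth_step.
rewrite ler_pdivrMr ?smooth_step_den_gt0// mulrAC ler_pdivlMr ?smooth_step_den_gt0//.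
rewrite !mulrDr [flat 0 y * flat 0 x]mulrC lerD2l.
apply: ler_pM; rewrite ?flat_ge0 ?flat0_homo//.
by rewrite lerD2l lerN2.
Qed.

Lemma nderivable_smooth_step n : nderivable n smooth_step.
Proof.
apply: (@nderivableM _ _ (flat 0) (fun x => (flat 0 x + flat 0 (1 - x))^-1)).
  exact: nderivable_flat.
apply: (@nderivableV _ _ (fun x => flat 0 x + flat 0 (1 - x))).
  by move=> x; rewrite gt_eqF// smooth_step_den_gt0.
apply: (@nderivableD _ _ (flat 0)); first exact: nderivable_flat.
have -> : (fun x : R => flat 0 (1 - x)) = (fun x => flat 0 (-1 * x + 1)).
  by apply/funext => x; rewrite mulN1r addrC.
by apply: nderivable_affine; exact: nderivable_flat.
Qed.

Lemma smooth_cutoff (p q : R) : p < q -> exists A : R -> R,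
  [/\ forall n, nderivable n A,
      {homo A : x y /~ x <= y},
      forall x, x <= p -> A x = 1 &
      forall x, q <= x -> A x = 0].
Proof.
move=> pq; have qp0 : 0 < q - p by rewrite subr_gt0.
exists (fun x => smooth_step ((- (q - p)^-1) * x + q / (q - p))).
have E x : - (q - p)^-1 * x + q / (q - p) = (q - x) / (q - p) by field; rewrite gt_eqF.
split.
- by move=> n; apply: nderivable_affine; exact: nderivable_smooth_step.
- move=> x y yx; apply: smooth_step_homo; rewrite !E ler_pM2r ?invr_gt0//.
  by rewrite lerD2l lerN2.
- move=> x xp; apply: smooth_step_ge1; rewrite E ler_pdivlMr// mul1r.
  by rewrite lerD2l lerN2.
- move=> x qx; apply: smooth_step_le0; rewrite E.
  by rewrite pmulr_lle0 ?invr_gt0// subr_le0.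
Qed.

End smooth_step.

(** * Affine changes of variables and power kernels *)

Section kernels.
Context {R : realType}.
Local Notation mu := (@lebesgue_measure R).
Implicit Types (a b : R).
Local Open Scope ereal_scope.

(** The image of Lebesgue measure under x |-> a x + b agrees with its multiple by
    1/a on half-open intervals, hence everywhere. *)
Lemma ge0_integral_affine (a b : R) (G : R -> \bar R) : (0 < a)%R ->
  measurable_fun [set: R] G -> (forall x, 0 <= G x) ->
  \int[mu]_x G x = a%:E * \int[mu]_x G (a * x + b)%R.
Proof.
move=> a0 mG G0.
pose phi (x : measurableTypeR R) : measurableTypeR R := (a * x + b)%R.
have mphi : measurable_fun [set: measurableTypeR R] phi.
  by apply: measurable_funD => //; exact: measurable_funM.
rewrite -[X in _ * X]/(\int[mu]_(x in phi @^-1` setT) (G \o phi) x).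
rewrite -(ge0_integral_pushforward mphi)//.
pose k := NngNum (ltW a0).
rewrite -[a%:E]/(k%:num%:E) -ge0_integral_mscale//.
apply: eq_measure_integral => A mA _.
apply: lebesgue_measure_unique => // _ [[c d]] _ <-.
rewrite -[RHS]/(a%:E * mu (phi @^-1` [set` `]c, d]%R])).
have -> : phi @^-1` [set` `]c, d]%R] =
    [set` `]((c - b) / a)%R, ((d - b) / a)%R]%R].
  apply/seteqP; split => x /=; rewrite !in_itv /= ltr_pdivrMr// ler_pdivlMr//;
    by rewrite ltrBlDr lerBrDr mulrC.
rewrite !lebesgue_measure_itv /= !lte_fin ltr_pM2r ?invr_gt0// ltrD2r.
case: ifPn => _; last by rewrite mule0.
by rewrite -!EFinB -EFinM; congr (_%:E); field; rewrite gt_eqF.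
Qed.

Lemma tonelli (F : R -> R -> \bar R) :
  measurable_fun [set: measurableTypeR R * measurableTypeR R]
    (fun z =>  F z.1 z.2) ->
  (forall x y, 0 <= F x y) ->
  \int[mu]_x \int[mu]_y F x y = \int[mu]_y \int[mu]_x F x y.
Proof. by move=> mF F0; apply: (@fubini_tonelli _ _ (measurableTypeR R) (measurableTypeR R)
  R mu mu (fun z => F z.1 z.2)). Qed.

Lemma measurable_partial_integral (F : R -> R -> \bar R) :
  measurable_fun [set: measurableTypeR R * measurableTypeR R]
    (fun z =>  F z.1 z.2) ->
  (forall x y, 0 <= F x y) ->
  measurable_fun [set: R] (fun x : R => \int[mu]_y F x y).
Proof.
by move=> mF F0; apply: (@measurable_fun_fubini_tonelli_F _ _
  (measurableTypeR R) (measurableTypeR R) R mu (fun z => F z.1 z.2)).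
Qed.

(** The power function cut off to ]0, +oo[; [pker 0] is the indicator of
    ]0, +oo[, so half-line integrals become integrals over the whole line, to
    which Tonelli applies. *)
Definition pker a (t : R) : R := ((0 < t)%R%:R * t `^ a)%R.

Lemma pker_ge0 a t : (0 <= pker a t)%R.
Proof. by rewrite mulr_ge0 ?powR_ge0// ler0n. Qed.

Lemma pker_gt0E a t : (0 < t)%R -> pker a t = (t `^ a)%R.
Proof. by move=> t0; rewrite /pker t0 mul1r. Qed.

Lemma pker_le0E a t : (t <= 0)%R -> pker a t = 0%R.
Proof. by move=> t0; rewrite /pker ltNge t0 mul0r. Qed.

Lemma pker_heaviside a t : a != 0%R -> pker a t = (heaviside t * t `^ a)%R.
Proof.
move=> a0; rewrite /pker /heaviside; case: ltgtP => // <-.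
by rewrite powR0// !mulr0.
Qed.

Lemma measurable_pker a : measurable_fun [set: R] (pker a).
Proof.
apply: measurable_funM => //.
have -> : (fun t : R => (0 < t)%R%:R : R)%R = \1_([set` `]0%R, +oo[%R] : set R).
  by apply/funext => t; rewrite indicE mem_setE in_itv /= andbT.
by [].
Qed.

Lemma pker_mul a b t : (pker a t * t `^ b)%R = pker (a + b) t.
Proof.
rewrite /pker; case: (ltP 0%R t) => t0; last by rewrite !mul0r.
by rewrite !mul1r powRD// (gt_eqF t0) implybT.
Qed.

Lemma pker_scale a (s t : R) : (0 < s)%R -> pker a (s * t) = (s `^ a * pker a t)%R.
Proof.
move=> s0; rewrite /pker pmulr_rgt0//; case: (ltP 0%R t) => t0.
  by rewrite !mul1r powRM// ltW.
by rewrite !mul0r mulr0.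
Qed.

Lemma integral_pker0 (G : R -> R) :
  \int[mu]_x (pker 0 x * G x)%:E = \int[mu]_(x in [set` `]0%R, +oo[%R]) (G x)%:E.
Proof.
rewrite [RHS]integral_mkcond; apply: eq_integral => x _.
rewrite /pker powRr0 mulr1 patchE mem_setE in_itv /= andbT.
by case: ifPn => x0; rewrite ?mul1r// mul0r.
Qed.

End kernels.

(** * The Beta convolution identity *)

Section gamma_beta.
Context {R : realType}.
Local Notation mu := (@lebesgue_measure R).
Implicit Types (a b : R).
Local Open Scope ereal_scope.

(** For -1 < b < 0 this is the Beta value B(b + 1, -b), in the form produced by
    the substitution x = t r. *)
Definition stieltjes_ker b : \bar R := \int[mu]_r (pker b r * (1 + r) `^ (-1))%:E.

(** For fixed t > 0 substitute x = t r: since a + b + 1 = 0 the powers of t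
    cancel.  After exchanging the integrals, scaling by 1 + r in t
    separates the two variables. *)
Lemma beta_convolution a b (H : R -> R) : (a + b + 1 = 0)%R ->
  measurable_fun [set: R] H -> (forall x, (0 <= H x)%R) ->
  \int[mu]_t \int[mu]_x (pker a t * (pker b x * H (x + t)))%:E =
  stieltjes_ker b * \int[mu]_z (pker 0 z * H z)%:E.
Proof.
move=> ab mH H0.
have P0 c d x y z : (0 <= pker c x * (pker d y * H z))%R.
  by rewrite mulr_ge0 ?pker_ge0// mulr_ge0 ?pker_ge0.
transitivity (\int[mu]_t \int[mu]_r (pker 0 t * (pker b r * H (t * (1 + r))))%:E).
  apply: eq_integral => t _.
  have [t0|t0] := leP t 0%R.
    by rewrite /= !pker_le0E//; apply: eq_integral => x _; rewrite !mul0r.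
  rewrite (@ge0_integral_affine _ t 0%R)//; last 2 first.
    apply/measurable_EFinP; apply: measurable_funM => //.
    apply: measurable_funM; first exact: measurable_pker.
    by apply: measurableT_comp => //; exact: measurable_funD.
    by move=> x; rewrite lee_fin.
  rewrite -ge0_integralZl//=.
  - apply: eq_integral => r _; rewrite -EFinM addr0 pker_scale// !(pker_gt0E _ t0).
    (* The factor t is the Jacobian of the substitution x = t r. *)
    have T : (t * t `^ a * t `^ b = 1)%R.
      rewrite -[X in (X * _ * _)%R](powRr1 (ltW t0)).
      rewrite -!powRD ?(gt_eqF t0) ?implybT//.
      by rewrite -addrA addrC ab powRr0.
    congr (_%:E); rewrite powRr0 mul1r mulrDr mulr1 -[RHS]mul1r -T.
    by rewrite [(t * r + t)%R]addrC !mulrA.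
  - apply/measurable_EFinP; apply: measurable_funM => //.
    apply: measurable_funM.
      apply: measurableT_comp; first exact: measurable_pker.
      by apply: measurable_funD => //; exact: measurable_funM.
    apply: measurableT_comp => //; apply: measurable_funD => //.
    by apply: measurable_funD => //; exact: measurable_funM.
  - by move=> r _; rewrite lee_fin.
  - by rewrite lee_fin ltW.
rewrite tonelli//; last 2 first.
- apply/measurable_EFinP; apply: measurable_funM.
    by apply: measurableT_comp => //; exact: measurable_pker.
  apply: measurable_funM.
    by apply: measurableT_comp => //; exact: measurable_pker.
  apply: measurableT_comp => //; apply: measurable_funM => //.
  exact: measurable_funD.
- by move=> x y; rewrite lee_fin.
rewrite /stieltjes_ker -ge0_integralZr//; last 3 first.
- apply/measurable_EFinP; apply: measurable_funM; first exact: measurable_pker.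
  apply: (measurableT_comp (measurable_powR _)).
  exact: measurable_funD.
- move=> r _; rewrite lee_fin; have [r0|r0] := leP r 0%R.
    by rewrite pker_le0E// mul0r.
  by rewrite mulr_ge0 ?pker_ge0 ?powR_ge0.
- by apply: integral_ge0 => z _; rewrite lee_fin mulr_ge0 ?pker_ge0.
apply: eq_integral => r _.
have [r0|r0] := leP r 0%R.
  rewrite pker_le0E// mul0r mul0e; apply: integral0_eq => t _.
  by rewrite mul0r mulr0.
have r1 : (0 < 1 + r)%R by lra.
rewrite [X in _ = _ * X](@ge0_integral_affine _ (1 + r) 0%R)//; last 2 first.
  by apply/measurable_EFinP; apply: measurable_funM => //; exact: measurable_pker.
  by move=> x; rewrite lee_fin mulr_ge0 ?pker_ge0.
rewrite muleA -EFinM powR_inv1 ?(ltW r1)// divfK ?gt_eqF// -ge0_integralZl//=; last 3 first.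
- apply/measurable_EFinP; apply: measurable_funM.
    apply: measurableT_comp; first exact: measurable_pker.
    by apply: measurable_funD => //; exact: measurable_funM.
  apply: measurableT_comp => //.
  by apply: measurable_funD => //; exact: measurable_funM.
- by move=> t _; rewrite lee_fin mulr_ge0 ?pker_ge0.
- by rewrite lee_fin pker_ge0.
apply: eq_integral => t _; rewrite -EFinM; congr (_%:E).
by rewrite addr0 pker_scale// powRr0 mul1r mulrCA [(t * _)%R]mulrC.
Qed.

End gamma_beta.

(** * The Gamma function *)

Section gamma_function.
Context {R : realType}.
Local Notation mu := (@lebesgue_measure R).
Implicit Types (a b : R).

Lemma integral_powR_pos a (c d : R) : 0 < a -> 0 < c -> c < d ->
  (\int[mu]_(s in `]c, d]) (s `^ (a - 1))%:E = ((d `^ a - c `^ a) / a)%:E)%E.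
Proof.
move=> a0 c0 cd.
have cpow e (x : R) : 0 < x -> {for x, continuous (fun s : R => s `^ e)}.
  move=> x0; apply/differentiable_continuous/derivable1_diffP.
  by apply: derivable_powR; rewrite in_itv /= andbT.
have dF (x : R) : 0 < x -> is_derive x 1 (fun s => a^-1 * s `^ a) (x `^ (a - 1)).
  move=> x0; have := is_deriveZ a^-1 (is_derive1_powR a x0).
  rewrite /GRing.scale /= => H; apply: (is_derive_eq H).
  by rewrite mulrA mulVf ?mul1r// gt_eqF.
rewrite integral_itv_obnd_cbnd; last first.
  by apply/measurable_EFinP; apply: measurable_funTS.
rewrite (@continuous_FTC2 _ _ (fun s => a^-1 * s `^ a))//.
- by rewrite -EFinB -mulrBr mulrC.
- apply/continuous_in_subspaceT => x; rewrite inE /= in_itv /= => /andP[cx _].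
  exact/cpow/(lt_le_trans c0).
- split.
  + move=> x; rewrite in_itv /= => /andP[cx _].
    by case: (dF x (lt_trans c0 cx)).
  + apply: cvg_at_right_filter; apply: cvgM; first exact: cvg_cst.
    exact: cpow.
  + apply: cvg_at_left_filter; apply: cvgM; first exact: cvg_cst.
    exact/cpow/(lt_trans c0).
- move=> x; rewrite in_itv /= => /andP[cx _].
  by rewrite derive1E; case: (dF x (lt_trans c0 cx)).
Qed.

(** The integrand may be singular at 0, so the fundamental theorem is applied on
    ]e, d] and e is sent to 0 by monotone convergence. *)
Lemma integral_powR_0 a (d : R) : 0 < a -> 0 < d ->
  (\int[mu]_(s in `]0%R, d]) (s `^ (a - 1))%:E = (d `^ a / a)%:E)%E.
Proof.
move=> a0 d0.
(* The shift by one keeps e 0 strictly below d. *)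
pose e n := d * harmonic n.+1.
have e0 n : 0 < e n by rewrite mulr_gt0 ?harmonic_gt0.
have ed n : e n < d by rewrite gtr_pMr// /harmonic invf_lt1 ?ltr1n ?ltr0n.
have nde : nonincreasing_seq e.
  by move=> m n mn; rewrite ler_pM2l// lef_pV2 ?posrE// ler_nat.
have ecvg : e n @[n --> \oo] --> 0.
  rewrite -[X in _ --> X](mulr0 d); apply: cvgM; first exact: cvg_cst.
  rewrite (cvg_shiftS (@harmonic R)); exact: cvg_harmonic.
have cup : [set` `]0, d]] = \bigcup_n [set` `](e n), d]] :> set R.
  apply/seteqP; split => [x|x [n _]] /=; rewrite !in_itv /=.
    move=> /andP[x0 xd].
    have [n _ /(_ n (leqnn n)) /= enx] := @cvgr_lt _ _ _ _ e 0 ecvg x x0.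
    by exists n => //=; rewrite in_itv /= enx.
  by move=> /andP[ex ->]; rewrite (lt_trans _ ex).
have := @ge0_nondecreasing_set_cvg_integral _ (measurableTypeR R) R (fun n => [set` `](e n), d]])
  (fun s : R => (s `^ (a - 1))%:E) mu.
rewrite -cup => H.
have {}H : (\int[mu]_(x in `](e n), d]) (x `^ (a - 1))%:E)%E @[n --> \oo] -->
   (\int[mu]_(x in `]0%R, d]) (x `^ (a - 1))%:E)%E.
  apply: H.
  - move=> m n mn; apply/subsetPset => x /=; rewrite !in_itv /= => /andP[ex ->].
    by rewrite (le_lt_trans _ ex)// nde.
  - by [].
  - by move=> n; apply/measurable_EFinP; apply: measurable_funTS.
  - by move=> n x _; rewrite lee_fin powR_ge0.
apply: (cvg_unique _ H) => //=.
rewrite [X in X @ _ --> _](_ : _ = (fun n => ((d `^ a - e n `^ a) / a)%:E)); last first.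
  by apply/funext => n; exact: integral_powR_pos.
apply: cvg_EFin; first exact: nearW.
rewrite -[X in _ --> X / a]subr0.
apply: cvgM; last exact: cvg_cst.
apply: cvgB; first exact: cvg_cst.
by have /cvg_at_rightP := powR_cvg0 a0; apply.
Qed.

Lemma integral_powR a (c d : R) : 0 < a -> 0 <= c -> c < d ->
  (\int[mu]_(s in `]c, d]) (s `^ (a - 1))%:E = ((d `^ a - c `^ a) / a)%:E)%E.
Proof.
move=> a0; rewrite le_eqVlt => /predU1P[<- d0|]; last exact: integral_powR_pos.
by rewrite integral_powR_0// powR0 ?subr0// gt_eqF.
Qed.

Local Open Scope ereal_scope.

(** The extended-real Gamma integral: it can be manipulated with Tonelli before
    it is known to be finite. *)
Definition gammaE (z : R) : \bar R :=
  \int[mu]_t (pker (z - 1) t * expR (- t))%:E.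

Lemma Gamma_gammaE z : Gamma z = fine (gammaE z).
Proof.
rewrite /Gamma /Rintegral /gammaE -integral_pker0; congr fine.
by apply: eq_integral => t _; rewrite mulrA pker_mul add0r.
Qed.

Lemma measurable_gamma_integrand (z : R) :
  measurable_fun [set: R] (fun t => (pker (z - 1) t * expR (- t))%:E).
Proof.
apply/measurable_EFinP; apply: measurable_funM; first exact: measurable_pker.
exact: measurableT_comp.
Qed.

Lemma gamma_integrand_ge0 (z t : R) : 0 <= (pker (z - 1) t * expR (- t))%:E.
Proof. by rewrite lee_fin mulr_ge0 ?pker_ge0 ?expR_ge0. Qed.

Lemma integral_expRN : \int[mu]_t (pker 0 t * expR (- t))%:E = 1.
Proof.
rewrite integral_pker0 integral_itv_obnd_cbnd; last first.
  apply/measurable_EFinP; apply: measurable_funTS; exact: measurableT_comp.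
rewrite -[RHS](@integral_exponential_pdf R 1%R ltr01) integral_mkcond.
apply: eq_integral => t _; rewrite /exponential_pdf !patchE.
by case: ifPn => // _; rewrite mul1r mulN1r.
Qed.

(** The integrand is at most t^(z-1) on ]0, 1] and exp(-t) beyond. *)
Lemma gammaE_lty (z : R) : (0 < z <= 1)%R -> gammaE z < +oo.
Proof.
move=> /andP[z0 z1].
pose h t : \bar R := (((fun s : R => s `^ (z - 1)) \_ [set` `]0%R, 1%R]%R]) t)%:E.
have mh : measurable_fun [set: R] h.
  apply/measurable_EFinP; apply/measurable_restrict => //.
  exact: measurable_funTS.
have h0 t : 0 <= h t.
  by rewrite lee_fin; apply: restrict_ge0 => s _; exact: powR_ge0.
have h1 (t : R) : 0 <= (pker 0 t * expR (- t))%:E.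
  by rewrite lee_fin mulr_ge0 ?pker_ge0 ?expR_ge0.
have m1 : measurable_fun [set: R] (fun t => (pker 0 t * expR (- t))%:E).
  apply/measurable_EFinP; apply: measurable_funM; first exact: measurable_pker.
  exact: measurableT_comp.
apply: (@le_lt_trans _ _ (\int[mu]_t (h t + (pker 0 t * expR (- t))%:E))).
  apply: ge0_le_integral => //.
  - by move=> t _; exact: gamma_integrand_ge0.
  - exact: measurable_gamma_integrand.
  - exact: emeasurable_funD.
  - move=> t _; rewrite -EFinD lee_fin patchE mem_setE in_itv /=.
    have [t0|t0] := leP t 0%R; first by rewrite !pker_le0E// !mul0r addr0.
    rewrite !pker_gt0E// powRr0 mul1r; have [t1|t1] /= := leP t 1%R.
      rewrite (le_trans (y := (t `^ (z - 1))%R)) ?lerDl ?expR_ge0//.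
      by rewrite ler_piMr ?powR_ge0// -expR0 ler_expR; lra.
    rewrite add0r ler_piMl ?expR_ge0// -[leRHS](powRr0 t) ler_powR//; first exact: ltW.
    by rewrite subr_le0.
rewrite ge0_integralD//= integral_expRN.
have -> : \int[mu]_t h t =
    \int[mu]_(s in [set` `]0%R, 1%R]%R]) (s `^ (z - 1))%:E.
  rewrite [RHS]integral_mkcond; apply: eq_integral => t _.
  by rewrite /h !patchE; case: ifPn.
by rewrite integral_powR// -EFinD ltry.
Qed.

Lemma gammaE_gt0 (z : R) : (0 < z)%R -> 0 < gammaE z.
Proof.
move=> z0.
have : 0 < (expR (-1) / z)%:E by rewrite lte_fin divr_gt0 ?expR_gt0.
move/lt_le_trans; apply.
apply: (@le_trans _ _ (\int[mu]_(t in [set` `]0%R, 1%R]%R])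
   (pker (z - 1) t * expR (- t))%:E)); last first.
  apply: ge0_subset_integral => //; first exact: measurable_gamma_integrand.
  by move=> t _; exact: gamma_integrand_ge0.
have -> : (expR (-1) / z)%:E = (expR (-1))%:E *
     \int[mu]_(s in [set` `]0%R, 1%R]%R]) (s `^ (z - 1))%:E.
  rewrite integral_powR// -EFinM powR1 powR0 ?gt_eqF// subr0 mul1r //.
rewrite -ge0_integralZl//=; last 2 first.
- by apply/measurable_EFinP; exact: measurable_funTS.
- by move=> s _; rewrite lee_fin powR_ge0.
apply: ge0_le_integral => //.
- by move=> s _; rewrite lee_fin mulr_ge0 ?powR_ge0 ?expR_ge0.
- apply/measurable_EFinP; apply: measurable_funM => //; exact: measurable_funTS.
- apply: measurable_funTS; exact: measurable_gamma_integrand.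
- move=> s /=; rewrite in_itv /= => /andP[s0 s1]; rewrite lee_fin pker_gt0E//.
  by rewrite mulrC ler_wpM2l ?powR_ge0// ler_expR lerN2.
Qed.

Lemma gammaE_fin_num (z : R) : (0 < z <= 1)%R -> gammaE z \is a fin_num.
Proof.
move=> z1; rewrite ge0_fin_numE ?gammaE_lty//.
by rewrite ltW// gammaE_gt0//; case/andP: z1.
Qed.

Lemma Gamma_gt0 (z : R) : (0 < z <= 1)%R -> (0 < Gamma z)%R.
Proof.
move=> z1; rewrite Gamma_gammaE fine_gt0// gammaE_lty// gammaE_gt0//.
by case/andP: z1.
Qed.

(** Write t^a as the integral of a s^(a-1) over ]0, t[ and exchange the order of
    integration; the inner integral of exp(-t) over ]s, +oo[ is exp(-s). *)
Lemma gammaE_D1 a : (0 < a)%R -> gammaE (1 + a) = a%:E * gammaE a.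
Proof.
move=> a0; rewrite /gammaE.
(* [pker 0 (t - s)] is the indicator of s < t. *)
pose F t s := ((a * expR (- t)) * (pker (a - 1) s * pker 0 (t - s)))%R.
have F0 t s : (0 <= F t s)%R.
  by apply: mulr_ge0; apply: mulr_ge0; rewrite ?expR_ge0 ?pker_ge0 ?(ltW a0).
have mF : measurable_fun [set: measurableTypeR R * measurableTypeR R]
    (fun z => (F z.1 z.2)%:E).
  apply/measurable_EFinP; apply: measurable_funM.
    apply: measurable_funM => //; apply: measurableT_comp => //.
    exact: measurableT_comp.
  apply: measurable_funM.
    by apply: measurableT_comp => //; exact: measurable_pker.
  apply: measurableT_comp; first exact: measurable_pker.
  exact: measurable_funB.
transitivity (\int[mu]_t \int[mu]_s (F t s)%:E).
  apply: eq_integral => t _; have [t0|t0] := leP t 0%R.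
    rewrite pker_le0E// mul0r integral0_eq// => s _; rewrite /F.
    have [s0|s0] := leP s 0%R; first by rewrite pker_le0E// mul0r mulr0.
    by rewrite (@pker_le0E _ 0 (t - s)%R) ?mulr0//; lra.
  rewrite /F; under eq_integral do rewrite EFinM.
  rewrite ge0_integralZl//=; last 3 first.
  - apply/measurable_EFinP; apply: measurable_funM; first exact: measurable_pker.
    apply: measurableT_comp; first exact: measurable_pker.
    exact: measurable_funB.
  - by move=> s _; rewrite lee_fin mulr_ge0 ?pker_ge0.
  - by rewrite lee_fin mulr_ge0 ?expR_ge0 ?ltW.
  have -> : \int[mu]_s (pker (a - 1) s * pker 0 (t - s))%:E =
      \int[mu]_(s in [set` `]0%R, t]%R]) (s `^ (a - 1))%:E.
    rewrite -integral_itv_bndo_bndc; last first.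
      by apply/measurable_EFinP; exact: measurable_funTS.
    rewrite [RHS]integral_mkcond; apply: eq_integral => s _.
    rewrite patchE mem_setE in_itv /=; have [s0|s0] /= := leP s 0%R.
      by rewrite pker_le0E// mul0r.
    case: ifPn => st; first by rewrite !pker_gt0E ?subr_gt0// powRr0 mulr1.
    by rewrite [X in (_ * X)%R]pker_le0E ?mulr0// subr_le0 leNgt.
  rewrite integral_powR// -EFinM; congr (_%:E).
  rewrite pker_gt0E// powR0 ?gt_eqF// subr0 addrAC subrr add0r.
  by rewrite mulrAC mulrCA divff ?gt_eqF// mulr1.
rewrite tonelli//.
rewrite -ge0_integralZl//=; last 3 first.
- exact: measurable_gamma_integrand.
- by move=> t _; exact: gamma_integrand_ge0.
- by rewrite lee_fin ltW.
apply: eq_integral => s _.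
rewrite (@ge0_integral_affine _ 1%R s)//; last 2 first.
- apply/measurable_EFinP; apply: measurable_funM.
    by apply: measurable_funM => //; exact: measurableT_comp.
  apply: measurable_funM => //.
  apply: measurableT_comp; first exact: measurable_pker.
  exact: measurable_funB.
- by move=> t; rewrite lee_fin.
rewrite mul1e; under eq_integral => t _.
  have -> : F (1 * t + s)%R s =
      ((a * (pker (a - 1) s * expR (- s))) * (pker 0 t * expR (- t)))%R.
    by rewrite /F mul1r addrK opprD expRD; ring.
  rewrite EFinM; over.
rewrite ge0_integralZl//=; last 3 first.
- apply/measurable_EFinP; apply: measurable_funM; first exact: measurable_pker.
  exact: measurableT_comp.
- by move=> t _; rewrite lee_fin mulr_ge0 ?pker_ge0 ?expR_ge0.
- by rewrite lee_fin mulr_ge0 ?(ltW a0)// mulr_ge0 ?pker_ge0 ?expR_ge0.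
by rewrite integral_expRN mule1.
Qed.

(** [beta_convolution] with H = exp(-.), for which both sides are explicit. *)
Lemma stieltjes_ker_gamma (g : R) : (0 < g < 1)%R ->
  stieltjes_ker (- g) = gammaE g * gammaE (1 - g).
Proof.
move=> /andP[g0 g1].
have := @beta_convolution R (g - 1) (- g) (fun x => expR (- x)).
rewrite integral_expRN mule1 => <-//; last 2 first.
- by lra.
- exact: measurableT_comp.
rewrite /gammaE -ge0_integralZr//; last 3 first.
- exact: measurable_gamma_integrand.
- by move=> t _; exact: gamma_integrand_ge0.
- by apply: integral_ge0 => t _; exact: gamma_integrand_ge0.
apply: eq_integral => t _; rewrite -ge0_integralZl//=; last 3 first.
- exact: measurable_gamma_integrand.
- by move=> x _; exact: gamma_integrand_ge0.
- exact: gamma_integrand_ge0.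
apply: eq_integral => x _; rewrite -EFinM; congr (_%:E).
by rewrite opprD expRD [(1 - g - 1)%R]addrAC subrr add0r; ring.
Qed.

End gamma_function.

(** * Differentiating a convolution *)

Section convolution_derivative.
Context {R : realType}.
Local Notation mu := (@lebesgue_measure R).

Lemma within_continuous_bounded (f : R -> R) (a b : R) : a <= b ->
  {within `[a, b], continuous f} ->
  exists2 M, 0 <= M & forall x, a <= x <= b -> `|f x| <= M.
Proof.
move=> ab cf.
have [c _ fc] := EVT_max ab (fun x => continuous_comp (cf x) (@norm_continuous _ _ _)).
by exists (`|f c|).
Qed.

Lemma integrable_bounded_support (h : R -> R) (c a b : R) :
  measurable_fun [set: R] h -> (forall y, `|h y| <= c * \1_(`[a, b]) y) ->
  mu.-integrable [set: R] (EFin \o h).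
Proof.
move=> mh hc.
apply: (@le_integrable _ (measurableTypeR R) _ mu _ _ _
  (fun y => c%:E * (\1_(`[a, b]) y)%:E)%E) => //.
- exact/measurable_EFinP.
- by move=> y _; rewrite -EFinM /= lee_fin (le_trans (hc y))// ler_norm.
- by apply: integrableZl => //; exact: integrable_indic_itv.
Qed.

Lemma derivable_continuous (f : R -> R) : (forall x, derivable f x 1) ->
  continuous f.
Proof. by move=> df x; exact/differentiable_continuous/derivable1_diffP. Qed.

(** K is bounded with compact support, so on a neighbourhood of a only the values
    of phi and its derivative on a compact interval matter, and these are
    bounded: differentiation under the integral sign applies. *)
Lemma derive1_convolution (K phi : R -> R) (M b a : R) :
  measurable_fun [set: R] K -> (forall y, `|K y| <= M * \1_(`[0, b]) y) ->
  (forall x, derivable phi x 1) -> continuous (derive1 phi) ->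
  derive1 (fun x => \int[mu]_y (K y * phi (x + y))) a =
  \int[mu]_y (K y * derive1 phi (a + y)).
Proof.
move=> mK KM dphi cdphi.
have cphi := derivable_continuous dphi.
have bnd (f : R -> R) : continuous f ->
    exists2 N, 0 <= N & forall x y, x \in `]a - 1, a + 1[ ->
      `|K y * f (x + y)| <= M * N * \1_(`[0, b]) y.
  move=> cf.
  have [b0|b0] := ltP b 0.
    exists 0 => // x y _; rewrite mulr0 mul0r normrM.
    have := KM y; rewrite indicE mem_setE in_itv /=.
    have -> : (0 <= y <= b) = false by apply/negP => /andP[]; lra.
    by rewrite mulr0 normr_le0 => /eqP ->; rewrite normr0 mul0r.
  have ab : a - 1 <= a + 1 + b by lra.
  have [N N0 fN] := within_continuous_bounded ab (continuous_subspaceT cf).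
  exists N => // x y; rewrite in_itv /= => /andP[x1 x2].
  rewrite normrM; have := KM y; rewrite indicE mem_setE in_itv /=.
  case: (boolP (0 <= y <= b)) => [/andP[y0 yb]|_].
    rewrite !mulr1 => KyM; rewrite ler_pM//; apply: fN; apply/andP; split; lra.
  by rewrite !mulr0 normr_le0 => /eqP ->; rewrite normr0 mul0r.
have mconv (f : R -> R) x : continuous f ->
    measurable_fun [set: R] (fun y => K y * f (x + y)).
  move=> cf; apply: measurable_funM => //.
  apply: measurableT_comp; first exact: continuous_measurable_fun.
  exact: measurable_funD.
have [N1 N10 B1] := bnd _ cphi.
have [N2 N20 B2] := bnd _ cdphi.
have dpart (x y : R) : is_derive x 1 (fun x => K y * phi (x + y))
    (K y * derive1 phi (x + y)).
  have ds : is_derive x 1 (fun x : R => x + y) 1 by exact: is_derive_shift.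
  have dc := @is_derive1_comp _ phi (fun x => x + y) x _ _
    (derivable_is_derive (dphi (x + y))) ds.
  by have := is_deriveZ (K y) dc; rewrite mulr1.
have -> := @differentiation_under_integral R _ (measurableTypeR R) mu
  (fun x y => K y * phi (x + y)) setT measurableT a (a - 1) (a + 1) _ _ _
  (fun y => M * N2 * \1_(`[0, b]) y).
- apply: eq_Rintegral => y _; rewrite partial1of2E.
  by case: (dpart a y).
- by rewrite /= in_itv /=; apply/andP; split; lra.
- move=> x xI; apply: (@integrable_bounded_support _ (M * N1) 0 b); first exact: mconv.
  by move=> y; exact: B1.
- by move=> x y _ _; case: (dpart x y).
- move=> y; apply: le_trans (B2 a y _) => //.
  by rewrite in_itv /=; apply/andP; split; lra.
- apply: (@integrableZl _ (measurableTypeR R) R mu setT measurableT (M * N2)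
    (EFin \o \1_(`[0, b]))); exact: integrable_indic_itv.
- move=> x y xI _; rewrite partial1of2E; case: (dpart x y) => _ ->.
  exact: B2.
Qed.

End convolution_derivative.

(** * Fractional potentials of the slope of a cut-off *)

Section cutoff_potential.
Context {R : realType}.
Local Notation mu := (@lebesgue_measure R).

(** The decrease to the value 0 at q is what recovers A as the integral of its
    nonnegative slope over half-lines. *)
Definition cutoff (q : R) (A : R -> R) : Prop :=
  [/\ 0 <= q, forall n, nderivable n A, {homo A : x y /~ x <= y},
      forall x, q <= x -> A x = 0 & forall x, A x <= 1].

(** Meant for the restrictions to [0, q] of the solution and of its initial
    value; the two are kept apart so that every integrand stays nonnegative. *)
Definition density (q M : R) (k : R -> R) : Prop :=
  [/\ measurable_fun [set: R] k, forall y, 0 <= k y &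
      forall y, k y <= M * \1_(`[0, q]) y].

Context (q : R) (A : R -> R) (hA : cutoff q A).

Let q_ge0 : 0 <= q. Proof. by case: hA. Qed.
Let A_smooth n : nderivable n A. Proof. by case: hA. Qed.
Let A_homo : {homo A : x y /~ x <= y}. Proof. by case: hA. Qed.
Let A_eq0 x : q <= x -> A x = 0. Proof. by case: hA => _ _ _ h _; exact: h. Qed.
Let A_le1 x : A x <= 1. Proof. by case: hA => _ _ _ _; exact. Qed.

Definition slope (s : R) : R := - derive1 A s.

Lemma derivable_cutoff (x : R) : derivable A x 1.
Proof. by have [] := A_smooth 1. Qed.

Lemma continuous_cutoff : continuous A.
Proof. exact: derivable_continuous derivable_cutoff. Qed.

Lemma cutoff_ge0 x : 0 <= A x.
Proof.
have [xq|qx] := leP x q; last by rewrite A_eq0// ltW.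
by rewrite -(A_eq0 (lexx q)) A_homo.
Qed.

Lemma continuous_slope : continuous slope.
Proof.
have [_ [dA _]] := A_smooth 2.
by move=> x; apply: continuousN; exact: derivable_continuous.
Qed.

Lemma slope_ge0 s : 0 <= slope s.
Proof.
have dN : is_derive s 1 (fun x => - A x) (slope s).
  exact/is_deriveN/derivable_is_derive/derivable_cutoff.
rewrite -(is_derive_derive1 dN); apply: nondecreasing_derive1_ge0; last first.
  by case: dN.
by move=> x y xy; rewrite lerN2 A_homo.
Qed.

Lemma measurable_slope : measurable_fun [set: R] slope.
Proof. by apply: continuous_measurable_fun; exact: continuous_slope. Qed.

(** Fundamental theorem on a half-line: A vanishes at infinity. *)
Lemma integral_slope_ge0 s :
  (\int[mu]_(z in `[0%R, +oo[) (slope (s + z))%:E = (A s)%:E)%E.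
Proof.
have dF (z : R) : is_derive z 1 (fun z => - A (s + z)) (slope (s + z)).
  have ds : is_derive z 1 (fun z : R => s + z) 1.
    rewrite (_ : (fun z => s + z) = shift s); first exact: is_derive_shift.
    by apply/funext => y; rewrite /= addrC.
  have dc := @is_derive1_comp _ A (fun z => s + z) z _ _
    (derivable_is_derive (@derivable_cutoff (s + z))) ds.
  by have := is_deriveN dc; rewrite mulr1.
have cF : continuous (fun z : R => - A (s + z)).
  by apply: derivable_continuous => z; case: (dF z).
rewrite (@ge0_continuous_FTC2y _ _ (fun z => - A (s + z)) 0 0).
- by rewrite addr0 EFinN oppeK add0e.
- by move=> z _; exact: slope_ge0.
- apply: continuous_subspaceT => z.
  apply: (@continuous_comp _ _ _ (fun z => s + z) slope).
    apply: continuousD; first by apply: cst_continuous.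
    exact: cvg_id.
  exact: continuous_slope.
- apply: (@cvg_trans _ ((cst (0 : R)) @ +oo%R)); last exact: cvg_cst.
  apply: near_eq_cvg; near=> z; rewrite /= A_eq0 ?oppr0//.
  rewrite -lerBlDl; near: z; apply: nbhs_pinfty_ge; exact: num_real.
- by move=> z _; case: (dF z).
- exact/cvg_at_right_filter/cF.
- by move=> z _; rewrite derive1E; case: (dF z).
Unshelve. all: by end_near. Qed.

Lemma integral_slope s :
  (\int[mu]_z (pker 0 z * slope (s + z))%:E = (A s)%:E)%E.
Proof.
rewrite integral_pker0 integral_itv_obnd_cbnd ?integral_slope_ge0//.
apply/measurable_EFinP; apply: measurable_funTS.
by apply: measurableT_comp; [exact: measurable_slope|exact: measurable_funD].
Qed.

Context (b : R) (b_gtN1 : -1 < b).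

Local Open Scope ereal_scope.

(** With b = -gamma, the pairing of the fractional integral of order 1 - gamma
    of k with the slope of the translate A(. + t), up to the factor
    Gamma(1 - gamma). *)
Definition potential (k : R -> R) (t : R) : \bar R :=
  \int[mu]_x \int[mu]_y (pker b x * (k y * slope (x + y + t)))%:E.

Section density.
Context (k : R -> R) (M : R) (hk : density q M k).

Let mk : measurable_fun [set: R] k. Proof. by case: hk. Qed.
Let k_ge0 y : (0 <= k y)%R. Proof. by case: hk. Qed.
Let k_le y : (k y <= M * \1_[set` `[0%R, q]%R] y)%R. Proof. by case: hk. Qed.

Let M_ge0 : (0 <= M)%R.
Proof.
have := k_le 0%R; rewrite indicE mem_setE in_itv /= lexx q_ge0 mulr1.
exact: le_trans.
Qed.

Lemma measurable_weighted_slope s :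
  measurable_fun [set: R] (fun y => (k y * slope (s + y))%:E).
Proof.
apply/measurable_EFinP; apply: measurable_funM => //.
by apply: measurableT_comp; [exact: measurable_slope|exact: measurable_funD].
Qed.

Lemma weighted_slope_ge0 s y : (0 <= k y * slope (s + y))%R.
Proof. by rewrite mulr_ge0// slope_ge0. Qed.

(** Since k <= M on [0, q], it is at most M times the total slope beyond s, which
    is A s. *)
Lemma integral_weighted_slope_le s :
  \int[mu]_y (k y * slope (s + y))%:E <= (M * A s)%:E.
Proof.
have ms : measurable_fun [set: R] (fun y => (slope (s + y))%:E).
  apply/measurable_EFinP; apply: measurableT_comp; first exact: measurable_slope.
  exact: measurable_funD.
rewrite EFinM -integral_slope_ge0 -ge0_integralZl//=; last 2 first.
- exact: measurable_funTS.
- by move=> y _; rewrite lee_fin slope_ge0.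
rewrite [leRHS]integral_mkcond; apply: ge0_le_integral => //.
- by move=> y _; rewrite lee_fin weighted_slope_ge0.
- exact: measurable_weighted_slope.
- apply/(measurable_restrictT _ _).1 => //; apply: measurable_funTS.
  exact: measurable_funeM.
- move=> y _; rewrite patchE mem_setE in_itv /= andbT.
  have := k_le y; rewrite indicE mem_setE in_itv /=.
  have [y0|y0] /= := leP 0%R y.
    move=> kM; rewrite -EFinM lee_fin ler_wpM2r ?slope_ge0//.
    by rewrite (le_trans kM)// ler_piMr// lern1 leq_b1.
  by rewrite mulr0 => k0; rewrite lee_fin mulr_le0_ge0// slope_ge0.
Qed.

Lemma potentialE t : potential k t =
  \int[mu]_x ((pker b x)%:E * \int[mu]_y (k y * slope (x + t + y))%:E).
Proof.
apply: eq_integral => x _.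
have := @ge0_integralZl _ _ _ mu _ measurableT _
  (measurable_weighted_slope (x + t)) (pker b x)%:E.
move=> <-; last 2 first.
- by move=> y _; rewrite lee_fin weighted_slope_ge0.
- by rewrite lee_fin pker_ge0.
by apply: eq_integral => y _; rewrite -EFinM addrAC.
Qed.

Lemma measurable_integral_weighted_slope t :
  measurable_fun [set: R] (fun x => \int[mu]_y (k y * slope (x + t + y))%:E).
Proof.
apply: (@measurable_partial_integral _ (fun x y => (k y * slope (x + t + y))%:E)).
  apply/measurable_EFinP; apply: measurable_funM; first exact: measurableT_comp.
  apply: measurableT_comp; first exact: measurable_slope.
  by apply: measurable_funD => //; exact: measurable_funD.
by move=> x y; rewrite lee_fin weighted_slope_ge0.
Qed.

(** The inner integral is at most M A(x + t), hence bounded by M and null for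
    x > q; x^b is integrable on ]0, q]. *)
Lemma potential_lty t : (0 <= t)%R -> potential k t < +oo.
Proof.
move=> t0; rewrite potentialE.
pose h x := ((fun x => M * x `^ b) \_ [set` `]0%R, q]%R])%R x.
have h0 x : (0 <= h x)%R.
  by apply: restrict_ge0 => y _; rewrite mulr_ge0 ?powR_ge0.
apply: (@le_lt_trans _ _ (\int[mu]_x (h x)%:E)).
  apply: ge0_le_integral => //.
  - move=> x _; rewrite mule_ge0 ?lee_fin ?pker_ge0//.
    by apply: integral_ge0 => y _; rewrite lee_fin weighted_slope_ge0.
  - apply: emeasurable_funM; last exact: measurable_integral_weighted_slope.
    by apply/measurable_EFinP; exact: measurable_pker.
  - apply/measurable_EFinP; apply/measurable_restrict => //.
    by apply: measurable_funM => //; exact: measurable_funTS.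
  - move=> x _; have := integral_weighted_slope_le (x + t)%R.
    rewrite /h patchE mem_setE in_itv /=.
    have [x0|x0] /= := leP x 0%R; first by rewrite pker_le0E// mul0e.
    have pE : 0 <= (pker b x)%:E by rewrite lee_fin pker_ge0.
    move=> /(lee_wpmul2l pE) /le_trans; apply; rewrite -EFinM lee_fin.
    rewrite pker_gt0E//; case: ifPn => [_|]; last first.
      rewrite -ltNge => qx; rewrite A_eq0 ?mulr0//.
      by rewrite (le_trans (ltW qx))// lerDl.
    by rewrite mulrC ler_wpM2r ?powR_ge0// ler_piMr.
have [q0|q0] := ltP 0%R q; last first.
  rewrite integral0_eq ?ltry// => x _; rewrite /h patchE mem_setE in_itv /=.
  have -> // : (0 < x <= q)%R = false by apply/negP => /andP[]; lra.
rewrite (_ : \int[mu]_x (h x)%:E =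
    \int[mu]_(x in [set` `]0%R, q]%R]) (M%:E * (x `^ (b + 1 - 1))%:E)); last first.
  rewrite [RHS]integral_mkcond; apply: eq_integral => x _.
  by rewrite /h !patchE addrK; case: ifPn.
rewrite ge0_integralZl//=; last 2 first.
- by apply/measurable_EFinP; exact: measurable_funTS.
- by move=> x _; rewrite lee_fin powR_ge0.
have b1 : (0 < b + 1)%R by rewrite -ltrBlDr sub0r.
by rewrite integral_powR// -EFinM ltry.
Qed.

End density.
End cutoff_potential.

(** * The Caputo derivative tested on a cut-off *)

Section caputo_cutoff.
Context {R : realType}.
Local Notation mu := (@lebesgue_measure R).
Context (q : R) (A : R -> R) (hA : cutoff q A).
Context (g : R) (g01 : 0 < g < 1).

Lemma density_integrable_slope (M : R) k s : density q M k ->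
  mu.-integrable [set: R] (EFin \o (fun y => k y * slope A (s + y))).
Proof.
move=> hk; apply/integrableP; split; first exact: (measurable_weighted_slope hA hk).
under eq_integral => y _ do
  rewrite gee0_abs ?lee_fin ?(weighted_slope_ge0 hA hk)//.
by apply: le_lt_trans (integral_weighted_slope_le hA hk s) _; rewrite ltry.
Qed.

Lemma density_out (M : R) k y : density q M k -> ~~ (0 <= y <= q) -> k y = 0.
Proof.
move=> [_ k0 kM] /negbTE yq; apply/eqP; rewrite eq_le k0 andbT.
by have := kM y; rewrite indicE mem_setE in_itv /= yq mulr0.
Qed.

(** The integrand of [potential] in x, real valued to match the real-valued
    pairings of distributions. *)
Definition Rpotential (k : R -> R) (t x : R) : R :=
  pker (- g) x * \int[mu]_y (k y * slope A (x + t + y)).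

Lemma EFin_Rpotential (M : R) k t x : density q M k ->
  ((Rpotential k t x)%:E =
   (pker (- g) x)%:E * \int[mu]_y (k y * slope A (x + t + y))%:E)%E.
Proof.
move=> hk; rewrite /Rpotential EFinM fineK//.
by apply: (integrable_fin_num measurableT); exact: (density_integrable_slope _ hk).
Qed.

Let gN1 : -1 < - g. Proof. by case/andP: g01 => _; rewrite ltrN2. Qed.

Lemma Rpotential_ge0 (M : R) k t x : density q M k -> 0 <= Rpotential k t x.
Proof.
move=> hk; rewrite mulr_ge0 ?pker_ge0//; apply: Rintegral_ge0 => y _.
exact: (weighted_slope_ge0 hA hk).
Qed.

Lemma integral_Rpotential (M : R) k t : density q M k ->
  (\int[mu]_x (Rpotential k t x)%:E = potential A (- g) k t)%E.
Proof.
move=> hk; rewrite (potentialE hA _ hk); apply: eq_integral => x _.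
exact: EFin_Rpotential hk.
Qed.

Lemma integrable_Rpotential (M : R) k t : 0 <= t -> density q M k ->
  mu.-integrable [set: R] (EFin \o Rpotential k t).
Proof.
move=> t0 hk; apply/integrableP; split.
  rewrite (_ : EFin \o Rpotential k t = (fun x => (pker (- g) x)%:E *
      \int[mu]_y (k y * slope A (x + t + y))%:E)%E); last first.
    by apply/funext => x; exact: EFin_Rpotential hk.
  apply: emeasurable_funM; last exact: (measurable_integral_weighted_slope hA hk).
  by apply/measurable_EFinP; exact: measurable_pker.
under eq_integral => y _ do rewrite /comp gee0_abs ?lee_fin ?(Rpotential_ge0 _ _ hk)//.
by rewrite (integral_Rpotential _ hk) (potential_lty hA gN1 hk).
Qed.

(** The derivative in x of the inner convolution is computed for x > 0 only, where
    phi coincides with A(. + t) at all points x + y, y >= 0; there the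
    derivative of phi is minus the slope. *)
Lemma g_minus_cutoff (M : R) (kU kV w phi : R -> R) (t : R) : 0 <= t ->
  density q M kU -> density q M kV ->
  (forall y, 0 <= y <= q -> w y = kU y - kV y) -> (forall y, y < 0 -> w y = 0) ->
  (forall n, nderivable n phi) -> (forall s, 0 <= s -> phi s = A (s + t)) ->
  g_minus g (fun x => \int[mu]_y (w y * phi (x + y))) =
  (Gamma (1 - g))^-1 * (fine (potential A (- g) kU t) - fine (potential A (- g) kV t)).
Proof.
move=> t0 hU hV wE w0 smooth_phi phiE.
rewrite /g_minus; congr (_ * _); rewrite /distr_derive /regular.
have dphi x : derivable phi x 1 by have [] := smooth_phi 1.
have cdphi : continuous (derive1 phi).
  by have [_ [ddphi _]] := smooth_phi 2; exact: derivable_continuous.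
have dphiE s : 0 < s -> derive1 phi s = - slope A (s + t).
  move=> s0; rewrite opprK.
  have ds : is_derive s 1 (fun s => s + t) 1 by exact: is_derive_shift.
  have dA := derivable_is_derive (@derivable_cutoff _ _ _ hA (s + t)).
  have dc := @is_derive1_comp _ A (fun s => s + t) s _ _ dA ds.
  apply: is_derive_derive1; rewrite -[derive1 A _]mulr1.
  apply: (near_eq_is_derive (f := fun s => A (s + t))) => //.
  have : \forall y \near s, 0 < y by exact: lt_nbhsr.
  by apply: filterS => y y0; rewrite phiE// ltW.
pose K y := kU y - kV y.
have mK : measurable_fun [set: R] K.
  by apply: measurable_funB; [case: hU|case: hV].
have K_le y : `|K y| <= M * \1_(`[0, q]) y.
  case: hU => _ U0 Ule; case: hV => _ V0 Vle.
  rewrite ler_norml /K; have := U0 y; have := V0 y; have := Ule y; have := Vle y.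
  lra.
have inner x : 0 < x ->
    derive1 (fun x => \int[mu]_y (w y * phi (x + y))) x =
    - (\int[mu]_y (kU y * slope A (x + t + y)) -
       \int[mu]_y (kV y * slope A (x + t + y))).
  move=> x0.
  rewrite derive1E (@near_eq_derive _ _ _ _ (fun x => \int[mu]_y (K y * phi (x + y)))).
    rewrite -derive1E (derive1_convolution _ mK K_le)//.
    rewrite -RintegralB//; [|exact: (density_integrable_slope _ hU)|
      exact: (density_integrable_slope _ hV)].
    rewrite -mulN1r -RintegralZl//; last first.
      apply: (@integrableB _ (measurableTypeR R) R mu setT measurableT
        (EFin \o (fun y => kU y * slope A (x + t + y)))
        (EFin \o (fun y => kV y * slope A (x + t + y)))).
        exact: (density_integrable_slope _ hU).
      exact: (density_integrable_slope _ hV).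
    apply: eq_Rintegral => y _; rewrite /K.
    have [y0|y0] := leP 0 y; first by rewrite dphiE 1?addrAC; [ring|lra].
    have yq : ~~ (0 <= y <= q) by rewrite leNgt y0.
    by rewrite (density_out hU yq) (density_out hV yq) subrr !mul0r subrr mulr0.
  have : \forall x' \near x, 0 < x' by exact: lt_nbhsr.
  apply: filterS => x' x'0; apply: eq_Rintegral => y _.
  have [yq|yq] := boolP (0 <= y <= q); first by rewrite wE.
  have [y0|y0] := leP 0 y; last first.
    by rewrite w0// /K (density_out hU yq) (density_out hV yq) subrr.
  rewrite phiE; last by lra.
  have hA0 : A (x' + y + t) = 0.
    case: hA => _ _ _ A0 _; apply: A0.
    by move: yq; rewrite y0 /= -ltNge; lra.
  by rewrite hA0 !mulr0.
have -> : \int[mu]_x (heaviside x * x `^ (- g) *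
     derive1 (fun x => \int[mu]_y (w y * phi (x + y))) x) =
   \int[mu]_x (-1 * (Rpotential kU t x - Rpotential kV t x)).
  apply: eq_Rintegral => x _.
  rewrite -pker_heaviside; last by rewrite oppr_eq0 gt_eqF//; case/andP: g01.
  have [x0|x0] := leP x 0; first by rewrite /Rpotential !pker_le0E// !mul0r subrr mulr0.
  by rewrite inner// /Rpotential; ring.
have iU := integrable_Rpotential t0 hU; have iV := integrable_Rpotential t0 hV.
rewrite RintegralZl//; last exact: (@integrableB _ (measurableTypeR R) R mu setT
  measurableT (EFin \o Rpotential kU t) (EFin \o Rpotential kV t)).
by rewrite mulN1r opprK RintegralB// /Rintegral (integral_Rpotential t hU)
  (integral_Rpotential t hV).
Qed.

End caputo_cutoff.

(** * The balance for translated cut-offs *)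

Section weak_volterra.
Context {R : realType}.
Local Notation mu := (@lebesgue_measure R).
Context (q : R) (A : R -> R) (hA : cutoff q A).
Context (g : R) (g01 : 0 < g < 1).

(** A(. + t) is not compactly supported on the left; multiplying by a step that is
    1 on [0, +oo[ repairs this without changing its values on the support of
    the distributions involved. *)
Lemma cutoff_test_function (T t : R) : q < T -> 0 <= t ->
  let phi s := A (s + t) * smooth_step (s + 1) in
  [/\ test_function T phi, forall n, nderivable n phi,
      forall s, 0 <= s -> phi s = A (s + t) & continuous phi].
Proof.
move=> qT t0 phi.
have smooth_phi n : nderivable n phi.
  apply: nderivableM.
    have -> : (fun s => A (s + t)) = (fun s => A (1 * s + t)).
      by apply/funext => s; rewrite mul1r.
    by apply: nderivable_affine; case: hA.
  have -> : (fun s : R => smooth_step (s + 1)) = (fun s => smooth_step (1 * s + 1)).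
    by apply/funext => s; rewrite mul1r.
  by apply: nderivable_affine; exact: nderivable_smooth_step.
split => //.
- split; first exact: nderivable_derive1n.
  exists (-1), q; split => // s; apply: contraR; rewrite negb_and -!ltNge.
  case/orP => sq; rewrite /phi; first by rewrite smooth_step_le0 ?mulr0//; lra.
  by case: hA => _ _ _ A0 _; rewrite A0 ?mul0r//; lra.
- by move=> s s0; rewrite /phi smooth_step_ge1 ?mulr1//; lra.
- by apply: derivable_continuous => s; have [] := smooth_phi 1.
Qed.

Section balance.
Context (f u : R -> R) (u0 T M : R).
Context (f_ge0 : forall x, 0 <= x -> 0 <= f x)
  (f_nondecr : forall x y, 0 <= x -> x <= y -> f x <= f y).
Context (qT : q < T) (hu : strong_solution g f u0 T u).

Let kU y := \1_(`[0, q]) y * u y.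
Let kV y := \1_(`[0, q]) y * u0.

Context (hU : density q M kU) (hV : density q M kV).

(** The value of f(u) on ]0, q], extended by 0; the inner indicator keeps the
    argument of f nonnegative everywhere, so this function is nonnegative
    without any almost-everywhere proviso. *)
Definition forcing (s : R) : R := \1_(`]0, q]) s * f (\1_(`[0, q]) s * u s).

Lemma forcing_ge0 s : 0 <= forcing s.
Proof. by case: hU => _ U0 _; rewrite mulr_ge0// f_ge0// U0. Qed.

(** f is monotone only on [0, +oo[; precomposing with max 0 makes it monotone on
    the line, hence Borel. *)
Lemma measurable_forcing : measurable_fun [set: R] forcing.
Proof.
case: hU => mU U0 _.
apply: measurable_funM; first by [].
rewrite (_ : (fun s => _) = (fun x => f (Num.max 0 x)) \o kU); last first.
  by apply/funext => s /=; rewrite max_r.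
apply: measurableT_comp => //; apply: nondecreasing_measurable => //.
move=> x y xy; apply: f_nondecr; first by rewrite le_max lexx.
by rewrite ge_max le_max lexx /= le_max xy orbT.
Qed.

Lemma forcing_le s : `|forcing s| <= f M * \1_(`[0, q]) s.
Proof.
rewrite ger0_norm ?forcing_ge0// /forcing; case: hU => _ U0 UM.
have M0 : 0 <= M.
  apply: le_trans (U0 0) _; apply: le_trans (UM 0) _.
  by rewrite indicE mem_setE in_itv /= lexx; case: hA => -> _ _ _ _; rewrite mulr1.
rewrite [X in X * f _]indicE mem_setE in_itv /=.
have [/andP[s0 sq]|_] := boolP (0 < s <= q); last first.
  by rewrite mul0r mulr_ge0// f_ge0.
rewrite [X in _ <= _ * X]indicE mem_setE in_itv /= (ltW s0) sq mulr1 mul1r.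
apply: f_nondecr; first exact: U0.
by have := UM s; rewrite [X in _ * X]indicE mem_setE in_itv /= (ltW s0) sq mulr1.
Qed.

Lemma measurable_forcing_cutoff t :
  measurable_fun [set: R] (fun s => forcing s * A (s + t)).
Proof.
apply: measurable_funM; first exact: measurable_forcing.
apply: measurableT_comp; last exact: measurable_funD.
by apply: continuous_measurable_fun; exact: (continuous_cutoff hA).
Qed.

Lemma integrable_forcing_cutoff t :
  mu.-integrable [set: R] (EFin \o (fun s => forcing s * A (s + t))).
Proof.
apply: (@integrable_bounded_support _ _ (f M) 0 q).
  exact: measurable_forcing_cutoff.
move=> s; rewrite normrM; apply: le_trans (forcing_le s).
rewrite ler_piMr// ger0_norm; last exact: (cutoff_ge0 hA).
by case: hA.
Qed.

(** The equation D_c^gamma u = f(u) tested on A(. + t).  All three terms are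
    finite, so the signed identity can be rearranged into a nonnegative one. *)
Lemma potential_balance t : 0 <= t ->
  (potential A (- g) kU t = potential A (- g) kV t +
   (Gamma (1 - g))%:E * \int[mu]_s (forcing s * A (s + t))%:E)%E.
Proof.
move=> t0.
pose phi s := A (s + t) * smooth_step (s + 1).
have [test_phi smooth_phi phiE cphi] : [/\ test_function T phi,
    forall n, nderivable n phi, forall s, 0 <= s -> phi s = A (s + t)
    & continuous phi] by exact: cutoff_test_function.
case: hu => _ _ u_ge0 [v [int_v /(_ _ test_phi) v_weak v_ae]].
have gN1 : -1 < - g by case/andP: g01 => _; rewrite ltrN2.
have g1 : 0 < 1 - g <= 1 by case/andP: g01; lra.
have G0 := Gamma_gt0 g1.
have wE y : 0 <= y <= q -> (u y - u0) * heaviside y = kU y - kV y.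
  move=> yq; rewrite /kU /kV !indicE mem_setE in_itv /= yq !mul1r.
  by rewrite /heaviside; case/andP: yq => -> _; rewrite mulr1.
have w0 y : y < 0 -> (u y - u0) * heaviside y = 0.
  by move=> y0; rewrite /heaviside leNgt y0 mulr0.
have := @g_minus_cutoff R q A hA g g01 M kU kV _ phi t t0 hU hV wE w0 smooth_phi phiE.
rewrite -[LHS]/(caputo g u0 u phi) v_weak.
have -> : \int[mu]_(s in `]0, T[) (v s * phi s) =
    fine (\int[mu]_s (forcing s * A (s + t))%:E)%E.
  rewrite /Rintegral; congr fine.
  rewrite (_ : (\int[mu]_s _)%E =
     (\int[mu]_(s in `]0%R, T[) (forcing s * A (s + t))%:E)%E); last first.
    rewrite [RHS]integral_mkcond; apply: eq_integral => s _.
    rewrite patchE mem_setE in_itv /=; case: ifPn => // sT.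
    rewrite /forcing indicE mem_setE in_itv /=.
    have -> : (0 < s <= q) = false; last by rewrite !mul0r.
    apply/negbTE; apply: contra sT => /andP[-> sq] /=; exact: le_lt_trans qT.
  apply: ae_eq_integral => //.
  - apply/measurable_EFinP; apply: measurable_funM.
      by apply/measurable_EFinP; exact: measurable_int int_v.
    by apply: measurable_funTS; exact: continuous_measurable_fun.
  - apply/measurable_EFinP; apply: measurable_funTS.
    exact: measurable_forcing_cutoff.
  - case: v_ae => N [mN N0 sN]; exists N; split => // s /= neq.
    apply: sN => /= vE; apply: neq; rewrite /= in_itv /= => sT.
    case/andP: (sT) => s0 _; rewrite vE// (phiE s (ltW s0)).
    have [sq|sq] := leP s q.
      by rewrite /forcing !indicE !mem_setE !in_itv /= s0 (ltW s0) sq !mul1r.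
    case: hA => _ _ _ A0 _; rewrite A0 ?mulr0//; lra.
have fI := integrable_fin_num measurableT (integrable_forcing_cutoff t).
have fU : potential A (- g) kU t \is a fin_num.
  rewrite ge0_fin_numE ?(potential_lty hA gN1 hU)//.
  by rewrite -(integral_Rpotential hA g t hU); apply: integral_ge0 => x _;
    rewrite lee_fin (Rpotential_ge0 hA g t x hU).
have fV : potential A (- g) kV t \is a fin_num.
  rewrite ge0_fin_numE ?(potential_lty hA gN1 hV)//.
  by rewrite -(integral_Rpotential hA g t hV); apply: integral_ge0 => x _;
    rewrite lee_fin (Rpotential_ge0 hA g t x hV).
move=> H; rewrite -(fineK fI) -(fineK fU) -(fineK fV) -EFinM -EFinD H.
by congr (_%:E); field; rewrite gt_eqF.
Qed.

End balance.
End weak_volterra.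

(** * The Volterra equation tested on bumps *)

Section volterra_tested.
Context {R : realType}.
Local Notation mu := (@lebesgue_measure R).
Local Open Scope ereal_scope.

Section smeared_slope.
Context (q M g : R) (A k : R -> R) (hA : cutoff q A) (hk : density q M k).

Let mk : measurable_fun [set: R] k. Proof. by case: hk. Qed.
Let k0 y : (0 <= k y)%R. Proof. by case: hk. Qed.
Let sl0 := slope_ge0 hA.
Let msl := measurable_slope hA.

(** Taking the integral in x first turns [potential] into a one-dimensional
    integral in y, so that every later exchange involves only two variables. *)
Definition smeared_slope s := \int[mu]_x (pker (- g) x * slope A (x + s))%:E.

Lemma measurable_smeared_slope : measurable_fun [set: R] smeared_slope.
Proof.
apply: (@measurable_partial_integral _
  (fun s x => (pker (- g) x * slope A (x + s))%:E)).
  apply/measurable_EFinP; apply: measurable_funM.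
    by apply: measurableT_comp => //; exact: measurable_pker.
  by apply: measurableT_comp => //; exact: measurable_funD.
by move=> s x; rewrite lee_fin mulr_ge0 ?pker_ge0.
Qed.

Lemma smeared_slope_ge0 s : 0 <= smeared_slope s.
Proof.
by apply: integral_ge0 => x _; rewrite lee_fin mulr_ge0 ?pker_ge0.
Qed.

Lemma potential_smeared_slope t :
  potential A (- g) k t = \int[mu]_y ((k y)%:E * smeared_slope (y + t)%R).
Proof.
rewrite /potential (tonelli (F := fun x y =>
  (pker (- g) x * (k y * slope A (x + y + t)))%:E)).
- apply: eq_integral => y _; rewrite /smeared_slope.
  have msx : measurable_fun [set: R]
      (fun x => (pker (- g) x * slope A (x + (y + t)))%:E).
    apply/measurable_EFinP; apply: measurable_funM; first exact: measurable_pker.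
    by apply: measurableT_comp => //; exact: measurable_funD.
  have := @ge0_integralZl _ _ _ mu _ measurableT _ msx (k y)%:E => <-.
  + by apply: eq_integral => x _; rewrite -EFinM addrA mulrCA.
  + by move=> x _; rewrite lee_fin mulr_ge0 ?pker_ge0.
  + by rewrite lee_fin.
- apply/measurable_EFinP; apply: measurable_funM.
    by apply: measurableT_comp => //; exact: measurable_pker.
  apply: measurable_funM; first exact: measurableT_comp.
  by apply: measurableT_comp => //; apply: measurable_funD => //; exact: measurable_funD.
- by move=> x y; rewrite lee_fin mulr_ge0 ?pker_ge0// mulr_ge0.
Qed.

Lemma measurable_density_smeared_slope t :
  measurable_fun [set: R] (fun y => (k y)%:E * smeared_slope (y + t)%R).
Proof.
apply: emeasurable_funM; first exact/measurable_EFinP.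
apply: measurableT_comp; first exact: measurable_smeared_slope.
exact: measurable_funD.
Qed.

Lemma measurable_potential : measurable_fun [set: R] (potential A (- g) k).
Proof.
rewrite (_ : potential _ _ _ = fun t =>
    \int[mu]_y ((k y)%:E * smeared_slope (y + t)%R)); last first.
  by apply/funext => t; exact: potential_smeared_slope.
apply: (@measurable_partial_integral _
  (fun t y => (k y)%:E * smeared_slope (y + t)%R)).
  apply: emeasurable_funM.
    by apply/measurable_EFinP; exact: measurableT_comp.
  apply: measurableT_comp; first exact: measurable_smeared_slope.
  exact: measurable_funD.
by move=> t y; rewrite mule_ge0 ?lee_fin// smeared_slope_ge0.
Qed.

Lemma potential_ge0 t : 0 <= potential A (- g) k t.
Proof.
rewrite potential_smeared_slope; apply: integral_ge0 => y _.
by rewrite mule_ge0 ?lee_fin// smeared_slope_ge0.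
Qed.

(** Fractional integrals of orders gamma and 1 - gamma compose to a plain
    integral, and integrating the slope gives back A: after the exchange the
    inner double integral is a [beta_convolution] of the slope translated by y,
    whose integral over the half-line is A y. *)
Lemma integral_potential : (0 < g < 1)%R ->
  \int[mu]_t ((pker (g - 1) t)%:E * potential A (- g) k t) =
  stieltjes_ker (- g) * \int[mu]_y (k y * A y)%:E.
Proof.
move=> g01.
have mA : measurable_fun [set: R] A.
  by apply: continuous_measurable_fun; exact: (continuous_cutoff hA).
have A0 := cutoff_ge0 hA.
pose Q := smeared_slope; have mQ := measurable_smeared_slope; have Q0 := smeared_slope_ge0.
transitivity (\int[mu]_t \int[mu]_y ((k y)%:E * ((pker (g - 1) t)%:E * Q (y + t)%R))).
  apply: eq_integral => t _; rewrite potential_smeared_slope.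
  have mkQ := measurable_density_smeared_slope t.
  have := @ge0_integralZl _ _ _ mu _ measurableT _ mkQ (pker (g - 1) t)%:E => <-.
  - by apply: eq_integral => y _; rewrite muleCA.
  - by move=> y _; rewrite mule_ge0// lee_fin.
  - by rewrite lee_fin pker_ge0.
rewrite (tonelli (F := fun t y => (k y)%:E * ((pker (g - 1) t)%:E * Q (y + t)%R))); last 2 first.
- apply: emeasurable_funM.
    by apply/measurable_EFinP; exact: measurableT_comp.
  apply: emeasurable_funM.
    by apply/measurable_EFinP; apply: measurableT_comp => //; exact: measurable_pker.
  by apply: measurableT_comp => //; exact: measurable_funD.
- by move=> t y; rewrite mule_ge0 ?lee_fin// mule_ge0 ?lee_fin// pker_ge0.
have S0 : 0 <= @stieltjes_ker R (- g).
  by apply: integral_ge0 => r _; rewrite lee_fin mulr_ge0 ?pker_ge0 ?powR_ge0.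
have mkA : measurable_fun [set: R] (fun y => (k y * A y)%:E).
  by apply/measurable_EFinP; exact: measurable_funM.
have := @ge0_integralZl _ _ _ mu _ measurableT _ mkA (stieltjes_ker (- g)) => <-//; last first.
  by move=> y _; rewrite lee_fin mulr_ge0.
apply: eq_integral => y _.
have mtQ : measurable_fun [set: R] (fun t => (pker (g - 1) t)%:E * Q (y + t)%R).
  apply: emeasurable_funM.
    by apply/measurable_EFinP; exact: measurable_pker.
  by apply: measurableT_comp => //; exact: measurable_funD.
have := @ge0_integralZl _ _ _ mu _ measurableT _ mtQ (k y)%:E => ->; last 2 first.
- by move=> t _; rewrite mule_ge0// lee_fin pker_ge0.
- by rewrite lee_fin.
rewrite EFinM muleCA; congr (_ * _).
rewrite -(integral_slope hA) -(@beta_convolution R (g - 1) (- g)); last 3 first.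
- lra.
- by apply: measurableT_comp => //; exact: measurable_funD.
- by move=> x; exact: sl0.
apply: eq_integral => t _.
have msx : measurable_fun [set: R] (fun x => (pker (- g) x * slope A (x + (y + t)))%:E).
  apply/measurable_EFinP; apply: measurable_funM; first exact: measurable_pker.
  by apply: measurableT_comp => //; exact: measurable_funD.
have := @ge0_integralZl _ _ _ mu _ measurableT _ msx (pker (g - 1) t)%:E => <-.
- by apply: eq_integral => x _; rewrite -EFinM [(y + (x + t))%R]addrCA.
- by move=> x _; rewrite lee_fin mulr_ge0 ?pker_ge0.
- by rewrite lee_fin pker_ge0.
Qed.

End smeared_slope.

Lemma mule_cancel (c : R) (x y : \bar R) : (0 < c)%R ->
  c%:E * x = c%:E * y -> x = y.
Proof.
move=> c0 /(congr1 (fun z => c^-1%:E * z)).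
by rewrite !muleA -!EFinM mulVf ?gt_eqF// !mul1e.
Qed.

Lemma adde_cancel (x y z : \bar R) : x \is a fin_num -> x + y = x + z -> y = z.
Proof.
by move=> fx /(congr1 (fun t => t - x)); rewrite ![x + _]addeC !addeK.
Qed.

Lemma affine_cancel (c : R) (x x' y y' m m' : \bar R) :
  x \is a fin_num -> y \is a fin_num -> c%:E * x = c%:E * y + m ->
  c%:E * (x + x') = c%:E * (y + y') + (m + m') -> c%:E * x' = c%:E * y' + m'.
Proof.
move=> fx fy E; rewrite !muleDr ?fin_num_adde_defr// [RHS]addeACA -E.
by apply: adde_cancel; rewrite fin_numM.
Qed.

Section tested.
Context (g : R) (g01 : (0 < g < 1)%R).
Context (f u : R -> R) (u0 T M q : R).
Context (f_ge0 : forall x, (0 <= x)%R -> (0 <= f x)%R)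
  (f_nondecr : forall x y, (0 <= x)%R -> (x <= y)%R -> (f x <= f y)%R).
Context (qT : (q < T)%R) (hu : strong_solution g f u0 T u).

Let kU y := (\1_[set` `[0%R, q]%R] y * u y)%R.
Let kV y := (\1_[set` `[0%R, q]%R] y * u0)%R.

Context (hU : density q M kU) (hV : density q M kV).

(** Gamma(gamma) times the integral of D against the fractional integral of order
    gamma of [forcing]. *)
Definition memory (D : R -> R) : \bar R :=
  \int[mu]_t ((pker (g - 1) t)%:E * \int[mu]_s (forcing q f u s * D (s + t))%:E).

(** Integrate [potential_balance] against t^(gamma-1) dt and divide by
    Gamma(1 - gamma). *)
Lemma tested_volterra_cutoff (A : R -> R) : cutoff q A ->
  (Gamma g)%:E * \int[mu]_y (kU y * A y)%:E =
  (Gamma g)%:E * \int[mu]_y (kV y * A y)%:E + memory A.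
Proof.
move=> hA; have g1 : (0 < 1 - g <= 1)%R by case/andP: g01; lra.
have g2 : (0 < g <= 1)%R by case/andP: g01 => -> /ltW.
have G1 := Gamma_gt0 g1; have G2 := Gamma_gt0 g2.
have sE : stieltjes_ker (- g) = (Gamma g * Gamma (1 - g))%:E.
  by rewrite stieltjes_ker_gamma// !Gamma_gammaE EFinM !fineK// gammaE_fin_num.
have A0 := cutoff_ge0 hA.
have mA : measurable_fun [set: R] A.
  by apply: continuous_measurable_fun; exact: (continuous_cutoff hA).
have F0 := forcing_ge0 f_ge0 hU.
have mF := measurable_forcing f_nondecr hU.
pose I t := \int[mu]_s (forcing q f u s * A (s + t))%:E.
have I0 t : 0 <= I t.
  by apply: integral_ge0 => s _; rewrite lee_fin mulr_ge0.
have mI : measurable_fun [set: R] I.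
  apply: (@measurable_partial_integral _
    (fun t s => (forcing q f u s * A (s + t))%:E)).
    apply/measurable_EFinP; apply: measurable_funM; first exact: measurableT_comp.
    by apply: measurableT_comp => //; exact: measurable_funD.
  by move=> t s; rewrite lee_fin mulr_ge0.
have mp := @measurable_pker R (g - 1).
have mpI : measurable_fun [set: R] (fun t => (pker (g - 1) t)%:E * I t).
  by apply: emeasurable_funM => //; exact/measurable_EFinP.
have pI0 t : 0 <= (pker (g - 1) t)%:E * I t.
  by rewrite mule_ge0// lee_fin pker_ge0.
have bal t := @potential_balance R q A hA g g01 f u u0 T M f_ge0 f_nondecr qT hu hU hV t.
have memory0 : 0 <= memory A by apply: integral_ge0 => t _; exact: pI0.
have memoryE : memory A = \int[mu]_t ((pker (g - 1) t)%:E * I t) by [].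
move: sE bal G1 G2 memory0; move: (Gamma g) (Gamma (1 - g)) => c d sE bal d0 c0 memory0.
have : \int[mu]_t ((pker (g - 1) t)%:E * potential A (- g) kU t) =
    \int[mu]_t ((pker (g - 1) t)%:E * potential A (- g) kV t) +
    d%:E * memory A.
  rewrite memoryE.
  have dE0 : 0 <= d%:E by rewrite lee_fin ltW.
  have := @ge0_integralZl _ _ _ mu _ measurableT _ mpI d%:E => <-//.
    rewrite -ge0_integralD//.
    - apply: eq_integral => t _; have [t0|t0] := leP t 0%R.
        by rewrite pker_le0E// !mul0e mule0 adde0.
      rewrite bal ?(ltW t0)//.
      rewrite muleDr//; first by rewrite muleCA.
      rewrite ge0_adde_def// inE ?(potential_ge0 g hA hV)//.
      exact: (mule_ge0 dE0 (I0 t)).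
    - by move=> t _; rewrite mule_ge0 ?lee_fin ?pker_ge0// (potential_ge0 g hA hV).
    - apply: emeasurable_funM; first exact/measurable_EFinP.
      exact: (measurable_potential g hA hV).
    - by move=> t _; exact: mule_ge0.
    - exact: measurable_funeM.
rewrite (integral_potential hA hU g01) (integral_potential hA hV g01) sE.
rewrite [(c * _)%R]mulrC EFinM -!muleA -muleDr//.
  exact: mule_cancel.
rewrite ge0_adde_def// inE.
apply: mule_ge0; first by rewrite lee_fin ltW.
by apply: integral_ge0 => y _; rewrite lee_fin mulr_ge0//; case: hV.
Qed.

(** Both sides are additive in the cut-off; all terms for A2 are finite and can be
    cancelled. *)
Lemma tested_volterra_bump (A1 A2 : R -> R) : cutoff q A1 -> cutoff q A2 ->
  (forall x, A2 x <= A1 x)%R ->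
  (Gamma g)%:E * \int[mu]_y (kU y * (A1 y - A2 y))%:E =
  (Gamma g)%:E * \int[mu]_y (kV y * (A1 y - A2 y))%:E +
  memory (fun x => A1 x - A2 x)%R.
Proof.
move=> h1 h2 le21; have g2 : (0 < g <= 1)%R by case/andP: g01 => -> /ltW.
have G2 := Gamma_gt0 g2.
pose D x := (A1 x - A2 x)%R.
have D0 x : (0 <= D x)%R by rewrite subr_ge0.
have m1 : measurable_fun [set: R] A1.
  by apply: continuous_measurable_fun; exact: (continuous_cutoff h1).
have m2 : measurable_fun [set: R] A2.
  by apply: continuous_measurable_fun; exact: (continuous_cutoff h2).
have A20 := cutoff_ge0 h2.
have mD : measurable_fun [set: R] D by exact: measurable_funB.
have F0 := forcing_ge0 f_ge0 hU.
have mF := measurable_forcing f_nondecr hU.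
have split_int k : density q M k -> \int[mu]_y (k y * A1 y)%:E =
    \int[mu]_y (k y * A2 y)%:E + \int[mu]_y (k y * D y)%:E.
  move=> [mk k0 _]; rewrite -ge0_integralD//.
  - by apply: eq_integral => y _; rewrite -EFinD -mulrDr /D addrCA subrr addr0.
  - by move=> y _; rewrite lee_fin mulr_ge0.
  - by apply/measurable_EFinP; exact: measurable_funM.
  - by move=> y _; rewrite lee_fin mulr_ge0.
  - by apply/measurable_EFinP; exact: measurable_funM.
have fin_int k : density q M k -> \int[mu]_y (k y * A2 y)%:E \is a fin_num.
  move=> [mk k0 kM]; apply: (integrable_fin_num measurableT).
  apply: (@integrable_bounded_support _ _ M 0 q); first exact: measurable_funM.
  move=> y; rewrite ger0_norm ?mulr_ge0//; apply: le_trans (kM y).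
  by rewrite ler_piMr//; case: h2.
have split_memory : memory A1 = memory A2 + memory D.
  have meas (B : R -> R) : measurable_fun [set: R] B -> (forall x, 0 <= B x)%R ->
      measurable_fun [set: R] (fun t => (pker (g - 1) t)%:E *
        \int[mu]_s (forcing q f u s * B (s + t))%:E).
    move=> mB B0; apply: emeasurable_funM.
      by apply/measurable_EFinP; exact: measurable_pker.
    apply: (@measurable_partial_integral _
      (fun t s => (forcing q f u s * B (s + t))%:E)).
      apply/measurable_EFinP; apply: measurable_funM; first exact: measurableT_comp.
      by apply: measurableT_comp => //; exact: measurable_funD.
    by move=> t s; rewrite lee_fin mulr_ge0.
  have int0 (B : R -> R) t : (forall x, 0 <= B x)%R ->
      0 <= \int[mu]_s (forcing q f u s * B (s + t))%:E.
    by move=> B0; apply: integral_ge0 => s _; rewrite lee_fin mulr_ge0.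
  rewrite /memory -ge0_integralD//; last 4 first.
  - by move=> t _; rewrite mule_ge0 ?lee_fin ?pker_ge0// int0.
  - exact: meas.
  - by move=> t _; rewrite mule_ge0 ?lee_fin ?pker_ge0// int0.
  - exact: meas.
  apply: eq_integral => t _; rewrite -muleDr//; last first.
    by rewrite ge0_adde_def// inE int0.
  congr (_ * _); rewrite -ge0_integralD//.
  - by apply: eq_integral => s _; rewrite -EFinD -mulrDr /D addrCA subrr addr0.
  - by move=> s _; rewrite lee_fin mulr_ge0.
  - apply/measurable_EFinP; apply: measurable_funM => //.
    by apply: measurableT_comp => //; exact: measurable_funD.
  - by move=> s _; rewrite lee_fin mulr_ge0.
  - apply/measurable_EFinP; apply: measurable_funM => //.
    by apply: measurableT_comp => //; exact: measurable_funD.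
have E2 := tested_volterra_cutoff h2.
have := tested_volterra_cutoff h1.
rewrite (split_int _ hU) (split_int _ hV) split_memory.
exact: affine_cancel (fin_int _ hU) (fin_int _ hV) E2.
Qed.
End tested.
End volterra_tested.

(** * The schemes as weighted sums *)

Section schemes.
Context {R : realType}.
Local Notation mu := (@lebesgue_measure R).
Context (g k : R) (g01 : 0 < g < 1) (k_gt0 : 0 < k).

Let g_gt0 : 0 < g. Proof. by case/andP: g01. Qed.
Let g_le1 : 0 < g <= 1. Proof. by case/andP: g01 => -> /ltW. Qed.

(** The integral of t^(gamma-1) over ]ik, (i+1)k]. *)
Definition cell_weight (i : nat) : R :=
  ((i.+1%:R * k) `^ g - (i%:R * k) `^ g) / g.

Lemma integral_cell i :
  (\int[mu]_(s in `](i%:R * k)%R, (i.+1%:R * k)%R]) (s `^ (g - 1))%:E =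
   (cell_weight i)%:E)%E.
Proof.
by rewrite integral_powR// ?mulr_ge0// ?ltW// ltr_pM2r// ltr_nat.
Qed.

Definition weighted_scheme (c : nat -> R) (f : R -> R) (u0 : R) (U : nat -> R) :=
  forall n, U n = u0 + \sum_(0 <= i < n) c i * f (U (n - i.+1)%N).

Definition admissible_weights (c : nat -> R) :=
  forall i, 0 <= c i /\ Gamma g * c i <= cell_weight i.

Lemma cell_weightE i :
  cell_weight i = k `^ g * ((i.+1%:R `^ g - i%:R `^ g) / g).
Proof. by rewrite /cell_weight !powRM ?(ltW k_gt0)// -mulrBl mulrAC mulrC. Qed.

Lemma Gamma_D1 : Gamma (1 + g) = g * Gamma g.
Proof.
rewrite !Gamma_gammaE gammaE_D1// fineM//; exact: gammaE_fin_num.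
Qed.

(** s^(gamma-1) is nonincreasing, so its integral over ]i, i+1] is at least its
    value at the right end point. *)
Lemma power_increment_ge (i : nat) :
  i.+1%:R `^ (g - 1) <= (i.+1%:R `^ g - i%:R `^ g) / g.
Proof.
rewrite -lee_fin -integral_powR//; last by rewrite ltr_nat.
have -> : (i.+1%:R `^ (g - 1))%:E =
    (\int[mu]_(s in `](i%:R : R), i.+1%:R]) (i.+1%:R `^ (g - 1))%:E)%E.
  rewrite integral_cst//= lebesgue_measure_itv/= lte_fin ltr_nat ltnSn.
  by rewrite -EFinD -[i.+1]addn1 natrD [(_ + 1%:R)%R]addrC addrK mule1.
apply: ge0_le_integral => //.
- by apply/measurable_EFinP; exact: measurable_funTS.
- move=> s /=; rewrite in_itv /= => /andP[si si1].
  have s0 : 0 < s by apply: le_lt_trans si.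
  have i0 : (0 : R) < i.+1%:R by rewrite ltr0n.
  rewrite lee_fin -[g - 1]opprB !powRN lef_pV2 ?posrE ?powR_gt0//.
  have g1 : 0 <= 1 - g by case/andP: g01 => _ /ltW; rewrite subr_ge0.
  by rewrite ge0_ler_powR ?nnegrE ?(ltW s0) ?(ltW i0).
Qed.

(** Here the weights are the exact cell integrals, by
    Gamma(1 + gamma) = gamma Gamma(gamma). *)
Lemma integral_scheme_weighted f u0 U : U 0%N = u0 -> integral_scheme g k f u0 U ->
  exists2 c, admissible_weights c & weighted_scheme c f u0 U.
Proof.
move=> U0 hU; have G0 := Gamma_gt0 g_le1.
exists (fun i => k `^ g / Gamma (1 + g) * (i.+1%:R `^ g - i%:R `^ g)).
  move=> i; split.
    rewrite Gamma_D1; apply: mulr_ge0.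
      by rewrite divr_ge0 ?powR_ge0// mulr_ge0// ltW.
    by rewrite subr_ge0 ge0_ler_powR ?nnegrE ?(ltW g_gt0)// ler_nat.
  rewrite cell_weightE Gamma_D1 le_eqVlt; apply/orP; left; apply/eqP.
  by field; rewrite !gt_eqF.
case=> [|n]; first by rewrite big_geq// addr0.
rewrite hU// big_nat_rev mulr_sumr; congr (_ + _).
apply: eq_big_nat => i /andP[_ iltn]; rewrite add0n.
have -> : (n.+1 - (n.+1 - i.+1) = i.+1)%N by rewrite subKn.
have -> : (n.+1 - (n.+1 - i.+1).+1 = i)%N by rewrite -subSn// subSS subKn// ltnW.
by rewrite mulrCA mulrC.
Qed.

Lemma pointwise_scheme_weighted f u0 U : U 0%N = u0 -> pointwise_scheme g k f u0 U ->
  exists2 c, admissible_weights c & weighted_scheme c f u0 U.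
Proof.
move=> U0 hU; have G0 := Gamma_gt0 g_le1.
exists (fun i => k `^ g / Gamma g * i.+1%:R `^ (g - 1)).
  move=> i; split.
    by rewrite mulr_ge0 ?divr_ge0 ?powR_ge0 ?ltW.
  rewrite cell_weightE mulrA mulrCA divff ?gt_eqF// mulr1.
  by rewrite ler_wpM2l ?powR_ge0// power_increment_ge.
case=> [|n]; first by rewrite big_geq// addr0.
rewrite hU// big_nat_rev mulr_sumr; congr (_ + _).
apply: eq_big_nat => i /andP[_ iltn]; rewrite add0n.
have -> : (n.+1 - (n.+1 - i.+1) = i.+1)%N by rewrite subKn.
by rewrite mulrCA mulrC.
Qed.

Section monotone.
Context (c : nat -> R) (hc : admissible_weights c) (f : R -> R) (u0 : R)
  (U : nat -> R).
Context (f_ge0 : forall x, 0 <= x -> 0 <= f x)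
  (f_nondecr : forall x y, 0 <= x -> x <= y -> f x <= f y)
  (u0_ge0 : 0 <= u0) (hU : weighted_scheme c f u0 U).

Lemma weighted_scheme_ge n : u0 <= U n.
Proof.
elim/ltn_ind: n => n IH; rewrite hU lerDl big_nat sumr_ge0// => i /andP[_ iltn].
rewrite mulr_ge0//; first by case: (hc i).
apply: f_ge0; apply: le_trans u0_ge0 (IH _ _).
by rewrite ltn_subrL (leq_ltn_trans _ iltn).
Qed.

(** Term by term U(n - i) >= U(n - 1 - i) by induction, and the sum for n + 1 has
    one more nonnegative term. *)
Lemma weighted_scheme_nondecr n : U n <= U n.+1.
Proof.
elim/ltn_ind: n => n IH; rewrite (hU n) (hU n.+1) lerD2l big_nat_recr//=.
rewrite -[leLHS]addr0 lerD//; last first.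
  rewrite mulr_ge0//; first by case: (hc n).
  by apply: f_ge0; exact: le_trans (weighted_scheme_ge _).
apply: ler_sum_nat => i /andP[_ iltn]; apply: ler_wpM2l; first by case: (hc i).
apply: f_nondecr; first exact: le_trans (weighted_scheme_ge _).
have -> : (n.+1 - i.+1 = (n - i.+1).+1)%N by rewrite subSn.
by apply: IH; rewrite ltn_subrL (leq_ltn_trans _ iltn).
Qed.

End monotone.
End schemes.

(** * Lower bounds for the memory integral *)

Section comparison.
Context {R : realType}.
Local Notation mu := (@lebesgue_measure R).

(** Two cut-offs, one stepping down in the last third of [a, b] and one in the
    first third. *)
Lemma smooth_bump (a b : R) : 0 <= a -> a < b -> exists A1 A2 : R -> R,
  [/\ cutoff b A1, cutoff b A2, forall x, A2 x <= A1 x,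
      forall x, ~~ (a < x < b) -> A1 x - A2 x = 0 &
      forall x, a + (b - a) / 3 <= x <= a + (b - a) / 3 * 2 -> A1 x - A2 x = 1].
Proof.
move=> a0 ab; set e := (b - a) / 3; have e0 : 0 < e by rewrite divr_gt0 ?subr_gt0.
have bE : b = a + e * 3 by rewrite /e divfK// addrC subrK.
have [A1 [s1 h1 one1 zero1]] : exists A : R -> R, [/\ forall n, nderivable n A,
    {homo A : x y /~ x <= y}, forall x, x <= a + e * 2 -> A x = 1
    & forall x, b <= x -> A x = 0] by apply: smooth_cutoff; rewrite bE; lra.
have [A2 [s2 h2 one2 zero2]] : exists A : R -> R, [/\ forall n, nderivable n A,
    {homo A : x y /~ x <= y}, forall x, x <= a -> A x = 1
    & forall x, a + e <= x -> A x = 0] by apply: smooth_cutoff; lra.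
have le1 (A : R -> R) p x : {homo A : x y /~ x <= y} ->
    (forall x, x <= p -> A x = 1) -> A x <= 1.
  move=> hA A1'; have [xp|px] := leP x p; first by rewrite A1'.
  by rewrite -(A1' p (lexx p)) hA// ltW.
have ge0 (A : R -> R) p x : {homo A : x y /~ x <= y} ->
    (forall x, p <= x -> A x = 0) -> 0 <= A x.
  move=> hA A0'; have [px|xp] := leP p x; first by rewrite A0'.
  by rewrite -(A0' p (lexx p)) hA// ltW.
exists A1, A2; split.
- split => //; first by lra.
  by move=> x; exact: le1 one1.
- split => //; first by lra.
    by move=> x bx; apply: zero2; lra.
  by move=> x; exact: le1 one2.
- move=> x; have [xa|ax] := leP x (a + e * 2); first by rewrite one1// (le1 _ _ _ h2 one2).
  by rewrite zero2; [exact: ge0 h1 zero1|lra].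
- move=> x; rewrite negb_and -!leNgt => /orP[xa|bx].
    by rewrite one1 ?one2 ?subrr//; lra.
  by rewrite zero1 ?zero2 ?subrr//; lra.
- by move=> x /andP[x1 x2]; rewrite one1// zero2// subr0.
Qed.

Lemma sum_cells_le_integral (h : R -> \bar R) (k : R) (m : nat) : 0 < k ->
  measurable_fun [set: R] h -> (forall t, 0 <= h t)%E ->
  (\sum_(0 <= i < m) \int[mu]_(t in `](i%:R * k)%R, (i.+1%:R * k)%R]) h t
    <= \int[mu]_t h t)%E.
Proof.
move=> k0 mh h0.
suff -> : (\sum_(0 <= i < m) \int[mu]_(t in `](i%:R * k)%R, (i.+1%:R * k)%R]) h t =
    \int[mu]_(t in `]0%R, (m%:R * k)%R]) h t)%E.
  by apply: ge0_subset_integral.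
elim: m => [|m IH].
  by rewrite big_geq// mul0r set_itvoc0 integral_set0.
rewrite big_nat_recr//= IH -ge0_integral_setU//=.
- congr (integral _ _ _); apply/seteqP; split => t /=; rewrite !in_itv /=.
  + case=> /andP[t1 t2]; apply/andP; split => //.
      by rewrite (le_trans t2)// ler_pM2r// ler_nat.
    by rewrite (le_lt_trans _ t1)// mulr_ge0// ltW.
  + move=> /andP[t1 t2]; have [tm|tm] := leP t (m%:R * k).
      by left; rewrite t1.
    by right.
- exact: measurable_funTS.
- apply/disj_set2P; rewrite -subset0 => t [] /=; rewrite !in_itv /=.
  by move=> /andP[_ tm] /andP[mt _]; move: mt; rewrite ltNge tm.
Qed.

Section volterra_lower_bound.
Context (g : R) (g01 : 0 < g < 1) (k : R) (k_gt0 : 0 < k).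
Context (f : R -> R)
  (f_ge0 : forall x, 0 <= x -> 0 <= f x)
  (f_nondecr : forall x y, 0 <= x -> x <= y -> f x <= f y).
Context (q M : R) (u : R -> R).

Let kU y := \1_(`[0, q]) y * u y.

(** For a lag t in the i-th cell, D(s + t) <> 0 forces s > mk - (i+1)k, where u is
    at least V(m-1-i); the remaining integral of D(. + t) is that of D by
    translation invariance. *)
Lemma memory_ge (V : nat -> R) (m : nat) (D : R -> R) :
  density q M kU ->
  measurable_fun [set: R] D -> (forall x, 0 <= D x) ->
  (forall x, ~~ (m%:R * k < x < q) -> D x = 0) ->
  (forall j, 0 <= V j) ->
  (forall j s, (j < m)%N -> 0 < s < q -> j%:R * k <= s -> V j <= u s) ->
  ((\sum_(0 <= i < m) cell_weight g k i * f (V (m - i.+1)%N))%:E *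
     \int[mu]_x (D x)%:E <= memory g f u q D)%E.
Proof.
move=> hU mD D0 Dsupp V0 Vu.
have F0 := forcing_ge0 f_ge0 hU.
have mF := measurable_forcing f_nondecr hU.
have ID0 : (0 <= \int[mu]_x (D x)%:E)%E by apply: integral_ge0 => x _; rewrite lee_fin.
pose J t := (\int[mu]_s (forcing q f u s * D (s + t))%:E)%E.
have J0 t : (0 <= J t)%E by apply: integral_ge0 => s _; rewrite lee_fin mulr_ge0.
have mJ : measurable_fun [set: R] J.
  apply: (@measurable_partial_integral _
    (fun t s => (forcing q f u s * D (s + t))%:E)).
    apply/measurable_EFinP; apply: measurable_funM; first exact: measurableT_comp.
    by apply: measurableT_comp => //; exact: measurable_funD.
  by move=> t s; rewrite lee_fin mulr_ge0.
have mp := @measurable_pker R (g - 1).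
have mh : measurable_fun [set: R] (fun t => (pker (g - 1) t)%:E * J t)%E.
  by apply: emeasurable_funM => //; exact/measurable_EFinP.
have h0 t : (0 <= (pker (g - 1) t)%:E * J t)%E.
  by rewrite mule_ge0// lee_fin pker_ge0.
(* Lags t > mk are discarded; the rest is cut into cells. *)
apply: le_trans (sum_cells_le_integral m k_gt0 mh h0).
rewrite -sumEFin ge0_sume_distrl; last first.
  move=> i _; rewrite lee_fin; apply: mulr_ge0; last exact: f_ge0.
  by rewrite -lee_fin -integral_cell//; apply: integral_ge0 => s _; rewrite lee_fin powR_ge0.
rewrite [X in (X <= _)%E]big_nat_cond [X in (_ <= X)%E]big_nat_cond.
apply: lee_sum => i; rewrite andbT => /andP[_ iltm].
set j := (m - i.+1)%N.
have jlt : (j < m)%N by rewrite ltn_subrL (leq_ltn_trans _ iltm).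
have fV0 : 0 <= f (V j) by exact: f_ge0.
rewrite EFinM -integral_cell// -muleA.
have fI0 : (0 <= (f (V j))%:E * \int[mu]_x (D x)%:E)%E by rewrite mule_ge0.
have := @ge0_integralZr _ _ _ mu [set` `](i%:R * k), (i.+1%:R * k)]] _
  (fun s => (s `^ (g - 1))%:E) _ ((f (V j))%:E * \int[mu]_x (D x)%:E)%E.
move=> <-//; last 2 first.
- by apply/measurable_EFinP; exact: measurable_funTS.
- by move=> s _; rewrite lee_fin powR_ge0.
apply: ge0_le_integral => //.
- by move=> t _; rewrite mule_ge0// lee_fin powR_ge0.
- apply: emeasurable_funM => //.
  by apply/measurable_EFinP; exact: measurable_funTS.
- exact: measurable_funTS.
move=> t /=; rewrite in_itv /= => /andP[it ti].
have t0 : 0 < t by apply: le_lt_trans it; rewrite mulr_ge0// ltW.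
rewrite pker_gt0E//; apply: lee_wpmul2l; first by rewrite lee_fin powR_ge0.
have mDt : measurable_fun [set: R] (fun s => (D (s + t))%:E).
  apply/measurable_EFinP; apply: measurableT_comp => //; exact: measurable_funD.
rewrite (@ge0_integral_affine _ 1 t (fun x => (D x)%:E))//; last first.
  exact/measurable_EFinP.
rewrite mul1e; under eq_integral do rewrite mul1r.
have := @ge0_integralZl _ _ _ mu _ measurableT _ mDt (f (V j))%:E => <-; last 2 first.
- by move=> s _; rewrite lee_fin.
- by [].
apply: ge0_le_integral => //.
- by move=> s _; rewrite mule_ge0 ?lee_fin.
- exact: measurable_funeM.
- apply/measurable_EFinP; apply: measurable_funM => //; exact/measurable_EFinP.
move=> s _; rewrite -EFinM lee_fin.
have [/andP[ms sq]|out] := boolP (m%:R * k < s + t < q); last by rewrite Dsupp// !mulr0.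
apply: ler_wpM2r => //.
have jk : j%:R * k < s.
  have : j%:R + i.+1%:R = m%:R :> R by rewrite -natrD subnK.
  move=> /(congr1 (fun x => x * k)); rewrite mulrDl => jE.
  rewrite -(ltrD2r t); apply: le_lt_trans ms.
  by rewrite -jE lerD2l.
have s0 : 0 < s by apply: le_lt_trans jk; rewrite mulr_ge0// ltW.
have sq' : s < q by lra.
rewrite /forcing !indicE !mem_setE !in_itv /= s0 (ltW s0) (ltW sq') !mul1r.
by apply: f_nondecr => //; apply: Vu; rewrite ?s0 ?ltW.
Qed.
End volterra_lower_bound.
End comparison.

(** * Comparison of the schemes with the solution *)

Section scheme_below_solution.
Context {R : realType}.
Local Notation mu := (@lebesgue_measure R).

Lemma density_of_bounded (q M : R) (h : R -> R) :
  measurable_fun `[0, q] h -> (forall y, 0 <= y <= q -> 0 <= h y <= M) ->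
  density q M (fun y => \1_(`[0, q]) y * h y).
Proof.
move=> mh hM; split.
- rewrite (_ : (fun y => _) = h \_ `[0, q]).
    by apply/measurable_restrict => //; rewrite setTI.
  apply/funext => y; rewrite patchE indicE mem_setE.
  by case: ifPn => _; rewrite ?mul1r ?mul0r.
- move=> y; rewrite indicE mem_setE in_itv /=.
  by have [/hM/andP[]|] := boolP (0 <= y <= q); rewrite ?mul1r// mul0r.
- move=> y; rewrite indicE mem_setE in_itv /=.
  by have [/hM/andP[]|] := boolP (0 <= y <= q); rewrite ?mul1r ?mulr1// mul0r mulr0.
Qed.

Lemma right_limit_ge0 (u : R -> R) (T : R) : 0 < T -> u x @[x --> 0^'+] --> u 0 ->
  (forall t, 0 < t < T -> 0 <= u t) -> 0 <= u 0.
Proof.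
move=> T0 cu u_ge0; rewrite leNgt; apply/negP => u0.
have /cvgr_lt/(_ 0 u0) := cu => Hneg.
have Hpos : \forall x \near 0^'+, 0 <= u x.
  near=> x; apply: u_ge0; apply/andP; split; near: x.
    exact: nbhs_right_gt.
  exact: nbhs_right_lt.
have [x [ux1 ux2]] : exists x, u x < 0 /\ 0 <= u x.
  apply: (@filter_ex _ (0 : R)^'+).
  by apply: filterS2 Hneg Hpos.
by move: ux1; rewrite ltNge ux2.
Unshelve. all: by end_near. Qed.

Section below.
Context (g : R) (g01 : 0 < g < 1) (k : R) (k_gt0 : 0 < k).
Context (f : R -> R)
  (f_ge0 : forall x, 0 <= x -> 0 <= f x)
  (f_nondecr : forall x y, 0 <= x -> x <= y -> f x <= f y).
Context (u0 : R) (u0_ge0 : 0 <= u0) (Tb : \bar R) (u : R -> R).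
Context (hu : continuous_strong_solution g f u0 Tb u).
Context (c : nat -> R) (hc : admissible_weights g k c) (U : nat -> R)
  (hU : weighted_scheme c f u0 U).

(** Tested on a bump D supported in ]a, b[, u is at most d, while by the Volterra
    equation and [memory_ge] it is at least
    u0 + sum_(i < m) c_i f(U(m-1-i)) = U(m). *)
Lemma strong_solution_lower_bound (m : nat) (d : R) (a b T : R) :
  (forall j s, (j < m)%N -> 0 < s -> (s%:E < Tb)%E -> j%:R * k <= s -> U j <= u s) ->
  0 < a -> m%:R * k <= a -> a < b -> b < T -> (T%:E < Tb)%E ->
  (forall s, a < s < b -> u s <= d) -> U m <= d.
Proof.
move=> IH a0 ma ab bT TTb ud.
have T0 : 0 < T by lra.
have [cu hsol] := hu.
have huT := hsol T T0 TTb.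
have [_ _ u_ge0 _] := huT.
have cuT : {within `[0, T], continuous u}.
  apply: continuous_subspaceW cu => t /=; rewrite in_itv /= => /andP[t0 tT].
  by split => //; apply: le_lt_trans TTb; rewrite lee_fin.
have [_ cu0 _] := (continuous_within_itvP u T0).1 cuT.
have u00 := right_limit_ge0 T0 cu0 u_ge0.
have cub : {within `[0, b], continuous u}.
  apply: continuous_subspaceW cuT => t /=; rewrite !in_itv /= => /andP[-> tb] /=.
  lra.
have b0 : 0 <= b by lra.
have [M0 M00 uM0] := within_continuous_bounded b0 cub.
(* A common bound for both densities. *)
pose M := Num.max M0 u0.
have hkU : density b M (fun y => \1_(`[0, b]) y * u y).
  apply: density_of_bounded.
    apply: subspace_continuous_measurable_fun => //.
  move=> y yb; apply/andP; split.
    case/andP: yb => y0 yb; move: y0; rewrite le_eqVlt => /predU1P[<-//|y0].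
    by apply: u_ge0; rewrite y0 /=; lra.
  rewrite le_max; apply/orP; left.
  by apply: le_trans (uM0 _ yb); rewrite ler_norm.
have hkV : density b M (fun y => \1_(`[0, b]) y * u0).
  apply: density_of_bounded => // y _.
  by rewrite u0_ge0 le_max lexx orbT.
have [A1 [A2 [hA1 hA2 A21 Dsupp Done]]] := smooth_bump (ltW a0) ab.
pose D x := A1 x - A2 x.
have D0 x : 0 <= D x by rewrite subr_ge0.
have mD : measurable_fun [set: R] D.
  apply: measurable_funB; apply: continuous_measurable_fun.
    exact: (continuous_cutoff hA1).
  exact: (continuous_cutoff hA2).
have := tested_volterra_bump g01 f_ge0 f_nondecr bT huT hkU hkV hA1 hA2 A21.
have Uge := weighted_scheme_ge hc f_ge0 u0_ge0 hU.
have mem : ((\sum_(0 <= i < m) cell_weight g k i * f (U (m - i.+1)%N))%:E *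
     \int[mu]_x (D x)%:E <= memory g f u b D)%E.
  apply: (memory_ge g01 k_gt0 f_ge0 f_nondecr hkU mD D0).
  - move=> x out; apply: Dsupp; apply: contra out => /andP[ax ->].
    by rewrite (le_lt_trans ma ax).
  - by move=> j; exact: le_trans (Uge j).
  - move=> j s jm /andP[s0 sb]; apply: IH => //.
    by apply: le_lt_trans TTb; rewrite lee_fin; lra.
rewrite -/D => E.
have g1 : 0 < g <= 1 by case/andP: g01 => -> /ltW.
have G0 := Gamma_gt0 g1.
have iD : mu.-integrable [set: R] (EFin \o D).
  apply: (@integrable_bounded_support _ _ 1 0 b) => // y.
  rewrite ger0_norm// mul1r indicE mem_setE in_itv /=.
  have [yb|yb] := boolP (0 <= y <= b).
    by case: hA1 => _ _ _ _ /(_ y); have := cutoff_ge0 hA2 y; rewrite /D /=; lra.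
  rewrite /D Dsupp//; apply: contra yb => /andP[ay yb]; apply/andP; split; lra.
pose I := fine (\int[mu]_x (D x)%:E)%E.
have IE : (\int[mu]_x (D x)%:E = I%:E)%E.
  by rewrite fineK//; exact: integrable_fin_num iD.
have I0 : 0 < I.
  rewrite -lte_fin -IE.
  have e0 : 0 < (b - a) / 3 by rewrite divr_gt0 ?subr_gt0.
  have eE : (((b - a) / 3)%:E = \int[mu]_(x in
      `[(a + (b - a) / 3)%R, (a + (b - a) / 3 * 2)%R]) (cst 1%E x))%E.
    rewrite integral_cst//= mul1e lebesgue_measure_itv/= lte_fin.
    rewrite ifT; last by lra.
    by rewrite -EFinB; congr (_%:E); lra.
  apply: (@lt_le_trans _ _ ((b - a) / 3)%:E); first by rewrite lte_fin.
  rewrite eE; apply: (@le_trans _ _ (\int[mu]_(x in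
      `[(a + (b - a) / 3)%R, (a + (b - a) / 3 * 2)%R]) (D x)%:E)%E).
    apply: ge0_le_integral => //.
      by apply/measurable_EFinP; exact: measurable_funTS.
    by move=> x /=; rewrite in_itv /= => xe; rewrite lee_fin /D Done.
  apply: ge0_subset_integral => //; first exact/measurable_EFinP.
  by move=> x _; rewrite lee_fin.
have ZI z : 0 <= z -> (\int[mu]_x (z * D x)%:E = (z * I)%:E)%E.
  move=> z0; rewrite EFinM -IE -ge0_integralZl//.
  - exact/measurable_EFinP.
  - by move=> x _; rewrite lee_fin.
have d0 : 0 <= d.
  have mid : a < (a + b) / 2 < b by apply/andP; split; lra.
  apply: le_trans (ud _ mid); apply: u_ge0.
  by case/andP: mid => m1 m2; apply/andP; split; lra.
have leU : (\int[mu]_y (\1_(`[0, b]) y * u y * D y)%:E <= (d * I)%:E)%E.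
  rewrite -ZI//; have [mkU kU0 _] := hkU; apply: ge0_le_integral => //.
  - by move=> y _; rewrite lee_fin mulr_ge0.
  - by apply/measurable_EFinP; exact: measurable_funM.
  - by apply/measurable_EFinP; exact: measurable_funM.
  - move=> y _; rewrite lee_fin.
    have [yab|out] := boolP (a < y < b); last by rewrite /D Dsupp// !mulr0.
    apply: ler_wpM2r => //; have := ud _ yab; case/andP: yab => ay yb.
    have y0 : 0 <= y by lra.
    by rewrite indicE mem_setE in_itv /= (ltW yb) y0 mul1r.
have geV : ((u0 * I)%:E <= \int[mu]_y (\1_(`[0, b]) y * u0 * D y)%:E)%E.
  rewrite -ZI// le_eqVlt; apply/orP; left; apply/eqP.
  apply: eq_integral => y _; congr (_%:E).
  have [/andP[ay yb]|out] := boolP (a < y < b); last by rewrite /D Dsupp// !mulr0.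
  have y0 : 0 <= y by lra.
  by rewrite indicE mem_setE in_itv /= (ltW yb) y0 mul1r.
have wsum : Gamma g * (U m - u0) <=
    \sum_(0 <= i < m) cell_weight g k i * f (U (m - i.+1)%N).
  rewrite hU addrAC subrr add0r mulr_sumr; apply: ler_sum => i _.
  rewrite mulrA ler_wpM2r//; last by case: (hc i).
  by apply: f_ge0; exact: le_trans (Uge _).
(* U(m) = u0 + (U(m) - u0): the first part is matched by the initial value and
   the second by the memory term. *)
move: E mem wsum G0; move: (Gamma g) (memory _ _ _ _ _) => G m0 E mem wsum G0.
have GE : (0 <= G%:E)%E by rewrite lee_fin ltW.
have : (G * (U m * I) <= G * (d * I))%R.
  rewrite -lee_fin [leRHS]EFinM.
  apply: le_trans (lee_wpmul2l GE leU); rewrite E.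
  apply: le_trans (leeD (lee_wpmul2l GE geV) mem); rewrite IE -!EFinM -EFinD lee_fin.
  have -> : G * (U m * I) = G * (u0 * I) + G * (U m - u0) * I by ring.
  by rewrite lerD2l ler_wpM2r// ltW.
by rewrite ler_pM2l// ler_pM2r.
Qed.

(** If u(s) < U(m), take d halfway between the two values: u stays below d on an
    interval to the right of s. *)
Lemma weighted_scheme_below (m : nat) s : 0 < s -> (s%:E < Tb)%E ->
  m%:R * k <= s -> U m <= u s.
Proof.
elim/ltn_ind: m s => m IH s s0 sTb ms.
rewrite leNgt; apply/negP => usU.
pose d := (u s + U m) / 2.
have usd : u s < d by rewrite /d; lra.
have dU : d < U m by rewrite /d; lra.
have [T sT TTb] : exists2 T, s < T & (T%:E < Tb)%E.
  case: (Tb) sTb => [r| |//]; rewrite ?lte_fin => sr.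
    by exists ((s + r) / 2); rewrite ?lte_fin; lra.
  by exists (s + 1); rewrite ?ltry//; lra.
have T0 : 0 < T by lra.
have cuT : {within `[0, T], continuous u}.
  have [cu _] := hu.
  apply: continuous_subspaceW cu => t /=; rewrite in_itv /= => /andP[t0 tT].
  by split => //; apply: le_lt_trans TTb; rewrite lee_fin.
have [cin _ _] := (continuous_within_itvP u T0).1 cuT.
have sin : s \in `]0, T[ by rewrite in_itv /= s0.
have /nbhs_ballP[e /= e0 be] : \forall x \near s, u x < d.
  exact: (cvgr_lt _ (cin s sin)).
(* Keeps ]s, b[ inside both the neighbourhood where u < d and ]0, T[. *)
pose b := s + Num.min (e / 2) ((T - s) / 2).
have min0 : 0 < Num.min (e / 2) ((T - s) / 2) by rewrite lt_min !divr_gt0 ?subr_gt0.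
have mine : Num.min (e / 2) ((T - s) / 2) <= e / 2 by rewrite ge_min lexx.
have minT : Num.min (e / 2) ((T - s) / 2) <= (T - s) / 2 by rewrite ge_min lexx orbT.
suff : U m <= d by rewrite leNgt dU.
apply: (@strong_solution_lower_bound m d s b T) => //.
- by move=> j x jm x0 xTb jx; exact: IH.
- by rewrite /b; lra.
- by rewrite /b; lra.
- move=> x /andP[sx xb]; apply: ltW; apply: be.
  by rewrite /ball /= distrC gtr0_norm; move: xb; rewrite /b; lra.
Qed.

End below.
End scheme_below_solution.

Theorem proposition6p3 (R : realType) (gamma : R) (f : R -> R) (u0 k : R)
  (U : nat -> R) (Tb : \bar R) (u : R -> R)
  (hgamma : 0 < gamma < 1)
  (f_ge0 : forall x, 0 <= x -> 0 <= f x)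
  (f_nondecr : forall x y, 0 <= x -> x <= y -> f x <= f y)
  (f_lip : locally_lipschitz_nonneg f)
  (u0_gt0 : 0 < u0) (k_gt0 : 0 < k)
  (U0 : U 0%N = u0)
  (hU : integral_scheme gamma k f u0 U \/ pointwise_scheme gamma k f u0 U)
  (Tb_gt0 : (0 < Tb)%E)
  (hu : maximal_solution gamma f u0 Tb u) :
  forall n : nat, (1 <= n)%N -> (n%:R%:E < Tb / k%:E)%E ->
    U n.-1 <= U n /\ U n <= u (n%:R * k).
Proof.
move=> n n_gt0 nTb.
have [c hc wU] : exists2 c, admissible_weights gamma k c & weighted_scheme c f u0 U.
  by case: hU; [exact: integral_scheme_weighted|exact: pointwise_scheme_weighted].
split.
  by rewrite -[in leRHS](prednK n_gt0);
    exact: (weighted_scheme_nondecr hc f_ge0 f_nondecr (ltW u0_gt0) wU).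
apply: (weighted_scheme_below hgamma k_gt0 f_ge0 f_nondecr (ltW u0_gt0) hu.1 hc wU) => //.
  by rewrite mulr_gt0// ltr0n.
move: nTb; rewrite EFinM; case: (Tb) => [r| |].
- rewrite inver gt_eqF// -!EFinM !lte_fin => nr.
  by rewrite -ltr_pdivlMr.
- by rewrite -EFinM ltry.
- by rewrite inver gt_eqF// gt0_mulNye ?lte_fin ?invr_gt0.
Qed.
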